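(* Let $n\ge2$ and let $\Omega\subset\mathbb{R}^n$ be a bounded Lipschitz domain. For any $m\in\mathbb{N}$ one has $$C_B^{(m)}(\Omega)\ge n.$$ If there exist $i\in\{1,\dots,n\}$ and $g\in\mathcal{K}_i(\Omega,\mathbb{R})\cap L^2(\Omega,\mathbb{R})$ such that the unique solution $w\in H^{m+1}_0(\Omega,\mathbb{R})$ to $$(-\Delta)^{m+1}w=g\ \text{ in }\Omega$$ satisfies $$\left\|\frac{\partial w}{\partial x_i}\right\|_{m,\Omega}^2<\frac1n\|w\|_{m+1,\Omega}^2,$$ then $C_B^{(m)}(\Omega)>n$.
   Context: Here $m=0$ is allowed. For $u,v\in H^m_0(\Omega,\mathbb{R})$, $$(u,v)_{m,\Omega}=\int_\Omega(\Delta^ku)(\Delta^kv)\,dx\ \text{ if }m=2k,\qquad(u,v)_{m,\Omega}=\int_\Omega\nabla(\Delta^ku)\cdot\nabla(\Delta^kv)\,dx\ \text{ if }m=2k+1;$$ this is a scalar product on $H^m_0(\Omega,\mathbb{R})$ whose norm, denoted $\|\cdot\|_{m,\Omega}$, is equivalent to the $H^m$-norm; the same notation is used for vector fields in $H^m_0(\Omega,\mathbb{R}^n)$ (sum over components). $L^2_0(\Omega,\mathbb{R})$ is the space of zero-mean functions in $L^2(\Omega,\mathbb{R})$ and $X_m(\Omega,\mathbb{R})=H^m_0(\Omega,\mathbb{R})\cap L^2_0(\Omega,\mathbb{R})$. The $m$-th order Bogovskii constant is $$C_B^{(m)}(\Omega)=\sup_{f\in X_m(\Omega,\mathbb{R}),\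 \|f\|_{m,\Omega}=1}\ \inf\Big\{\|v\|_{m+1,\Omega}^2;\ v\in H^{m+1}_0(\Omega,\mathbb{R}^n),\ \nabla\cdot v=f\text{ in }\Omega\Big\}.$$ $\mathcal{K}_i(\Omega,\mathbb{R})$ is the vector space of functions $g:\Omega\to\mathbb{R}$ depending at most on the $i$-th variable, $g(x)=g(x_i)$ for all $x\in\Omega$. The solution $w$ is the weak one: $(w,\varphi)_{m+1,\Omega}=\int_\Omega g\varphi\,dx$ for all $\varphi\in H^{m+1}_0(\Omega,\mathbb{R})$. *)

(* Defs.v *)
From HB Require Import structures.
From mathcomp Require Import all_boot all_order all_algebra.
From mathcomp Require Import all_classical all_reals all_analysis.

Set Implicit Arguments.
Unset Strict Implicit.
Unset Printing Implicit Defensive.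
Import Order.TTheory GRing.Theory Num.Theory.
Import numFieldNormedType.Exports.

Local Open Scope classical_set_scope.
Local Open Scope ring_scope.

(* The sigma-algebra on R^n is the one generated by the coordinates, as the
   library does for tuples; it coincides with the Borel sigma-algebra. *)
Section measurable_rV.
Context (R : realType) (n : nat).

Definition rV_coord (i : 'I_n) (x : 'rV[R]_n) : R := x 0 i.

Let rV_set0 : g_sigma_preimage rV_coord set0.
Proof. exact: sigma_algebra0. Qed.

Let rV_setC A : g_sigma_preimage rV_coord A -> g_sigma_preimage rV_coord (~` A).
Proof. exact: sigma_algebraC. Qed.

Let rV_bigcup (F : (set 'rV[R]_n)^nat) :
  (forall i, g_sigma_preimage rV_coord (F i)) ->
  g_sigma_preimage rV_coord (\bigcup_i (F i)).
Proof. exact: sigma_algebra_bigcup. Qed.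

HB.instance Definition _ := @isMeasurable.Build default_measure_display
  'rV[R]_n (g_sigma_preimage rV_coord) rV_set0 rV_setC rV_bigcup.

Lemma measurable_rV_coord (i : 'I_n) : measurable_fun setT (rV_coord i).
Proof.
move=> _ Y mY; rewrite setTI; apply: sub_sigma_algebra => /=.
rewrite -bigcup_seq/=; exists i => /=; first by rewrite mem_index_enum.
by exists Y => //; rewrite setTI.
Qed.

Lemma measurable_fun_rVP d (T : measurableType d) (f : T -> 'rV[R]_n) :
  (forall i, measurable_fun setT (rV_coord i \o f)) -> measurable_fun setT f.
Proof.
move=> mf _ A mA; rewrite setTI.
suff : g_sigma_preimage rV_coord `<=` [set B | measurable (f @^-1` B)].
  by move/(_ A mA).
apply: smallest_sub.
  split => /=.
  - by rewrite preimage_set0.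
  - by move=> B mB; rewrite setTD preimage_setC; exact: measurableC.
  - by move=> F mF; rewrite preimage_bigcup; exact: bigcup_measurable.
rewrite -bigcup_seq; apply: bigcup_sub => i _ _ [B mB <-] /=.
by rewrite setTI -comp_preimage -[X in measurable X]setTI; exact: mf.
Qed.

End measurable_rV.

Section rV_cons.
Context (R : realType) (n : nat).

Definition rV_cons (x : measurableTypeR R * 'rV[R]_n) : 'rV[R]_n.+1 :=
  \row_i (if unlift ord0 i is Some j then x.2 0 j else x.1).

Definition rV_uncons (x : 'rV[R]_n.+1) : measurableTypeR R * 'rV[R]_n :=
  (x 0 ord0, \row_j x 0 (lift ord0 j)).

Lemma rV_consK : cancel rV_cons rV_uncons.
Proof.
move=> [a y]; congr pair; first by rewrite mxE unlift_none.
by apply/rowP => j; rewrite !mxE liftK.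
Qed.

Lemma measurable_rV_cons : measurable_fun setT rV_cons.
Proof.
apply: measurable_fun_rVP => i.
case: (unliftP ord0 i) => [j ->|->].
  rewrite [X in measurable_fun _ X](_ : _ = @rV_coord R n j \o snd).
    by apply: measurableT_comp; [exact: measurable_rV_coord|].
  by apply/funext => x; rewrite /= /rV_coord mxE liftK.
rewrite [X in measurable_fun _ X](_ : _ = fst)//.
by apply/funext => x; rewrite /= /rV_coord mxE unlift_none.
Qed.

Lemma measurable_rV_uncons : measurable_fun setT rV_uncons.
Proof.
apply/measurable_fun_pairP; split; first exact: measurable_rV_coord.
apply: measurable_fun_rVP => i.
rewrite [X in measurable_fun _ X](_ : _ = @rV_coord R n.+1 (lift ord0 i)).
  exact: measurable_rV_coord.
by apply/funext => x; rewrite /= /rV_coord mxE.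
Qed.

Variable mu : {sigma_finite_measure set 'rV[R]_n -> \bar R}.

Definition lebesgue_cons : set 'rV[R]_n.+1 -> \bar R :=
  pushforward (@lebesgue_measure R \x mu)%E rV_cons.

Let measurable_preimage A : measurable A -> measurable (rV_cons @^-1` A).
Proof.
by move=> mA; rewrite -[X in measurable X]setTI; exact: measurable_rV_cons.
Qed.

Let lebesgue_cons0 : lebesgue_cons set0 = 0%E.
Proof. by rewrite /lebesgue_cons /pushforward preimage_set0 measure0. Qed.

Let lebesgue_cons_ge0 A : (0 <= lebesgue_cons A)%E.
Proof. by rewrite /lebesgue_cons /pushforward; exact: measure_ge0. Qed.

Let lebesgue_cons_sigma_additive : semi_sigma_additive lebesgue_cons.
Proof.
move=> F mF tF mUF; rewrite /lebesgue_cons /pushforward preimage_bigcup.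
apply: measure_semi_sigma_additive.
- by move=> k; exact: measurable_preimage.
- apply/trivIsetP => /= i j _ _ ij; rewrite -preimage_setI.
  by move/trivIsetP : tF => /(_ _ _ _ _ ij) ->//; rewrite preimage_set0.
- by rewrite -preimage_bigcup; exact: measurable_preimage.
Qed.

HB.instance Definition _ := isMeasure.Build _ _ _ lebesgue_cons
  lebesgue_cons0 lebesgue_cons_ge0 lebesgue_cons_sigma_additive.

Let lebesgue_cons_sigma_finite : sigma_finite setT lebesgue_cons.
Proof.
have /sigma_finiteP[F [TF ndF Foo]] := sigma_finiteT (@lebesgue_measure R).
have /sigma_finiteP[G [TG ndG Goo]] := sigma_finiteT mu.
exists (fun k => rV_uncons @^-1` (F k `*` G k)).
  rewrite -preimage_bigcup -(preimage_setT rV_uncons); congr (_ @^-1` _).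
  apply/esym/seteqP; split=> // -[x y] _.
  have [k _ Fx] : (\bigcup_k F k) x by rewrite -TF.
  have [l _ Gy] : (\bigcup_k G k) y by rewrite -TG.
  exists (maxn k l) => //; split => /=.
  - by move: x Fx; exact/subsetPset/ndF/leq_maxl.
  - by move: y Gy; exact/subsetPset/ndG/leq_maxr.
move=> k; have [mF Fk] := Foo k; have [mG Gk] := Goo k; split.
  rewrite -[X in measurable X]setTI; apply: measurable_rV_uncons => //.
  exact: measurableX.
rewrite /lebesgue_cons /pushforward -comp_preimage.
rewrite (_ : _ \o _ = id); last by apply/funext => x /=; rewrite rV_consK.
by rewrite preimage_id product_measure1E// lte_mul_pinfty// ge0_fin_numE.
Qed.

HB.instance Definition _ := Measure_isSigmaFinite.Build _ _ _ lebesgue_cons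
  lebesgue_cons_sigma_finite.

End rV_cons.

Fixpoint lebesgue_rV (R : realType) (n : nat) :
    {sigma_finite_measure set 'rV[R]_n -> \bar R} :=
  if n is k.+1 then
    [the sigma_finite_measure _ _ of lebesgue_cons (lebesgue_rV R k)]
  else [the sigma_finite_measure _ _ of \d_(0 : 'rV[R]_0)].

Lemma measurable_rV_box (R : realType) (n : nat) (A : 'I_n -> set R) :
  (forall i, measurable (A i)) ->
  measurable [set x : 'rV[R]_n | forall i, A i (x 0 i)].
Proof.
move=> mA; rewrite (_ : [set x | _] =
    \bigcap_(i in [set: 'I_n]) (@rV_coord R n i @^-1` A i)).
  apply: fin_bigcap_measurable; first exact: finite_finset.
  move=> i _; rewrite -[X in measurable X]setTI.
  by apply: measurable_rV_coord => //; exact: mA.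
by apply/seteqP; split=> x Ax i => [_|]; exact: Ax.
Qed.

Lemma lebesgue_rV_box (R : realType) (n : nat) (A : 'I_n -> set R) :
  (forall i, measurable (A i)) ->
  lebesgue_rV R n [set x | forall i, A i (x 0 i)] =
  (\prod_(i < n) @lebesgue_measure R (A i))%E.
Proof.
elim: n A => [|n IH] A mA.
  by rewrite big_ord0 /= diracE mem_set// => -[].
rewrite big_ord_recl -IH; last by move=> i; exact: mA.
have mA' := @measurable_rV_box R n _ (fun i => mA (lift ord0 i)).
rewrite -product_measure1E//; last exact: mA.
rewrite /= /lebesgue_cons /pushforward; congr ((_ \x _)%E _).
apply/seteqP; split=> -[a y] /=.
  move=> Ay; split=> [|i]; [have := Ay ord0|have := Ay (lift ord0 i)];
  by rewrite mxE ?unlift_none ?liftK.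
by move=> [Aa Ay] i; rewrite mxE; case: unliftP => [j ->|->].
Qed.

Section domains.
Context (R : realType) (n : nat).
Implicit Types Omega : set 'rV[R]_n.

(* Near each boundary point, after an orthogonal change of variables, the set is
   the strict epigraph of a Lipschitz function of the other n - 1 variables. *)
Definition lipschitz_boundary Omega :=
  forall x, (closure Omega `\` interior Omega) x ->
  exists (Q : 'M[R]_n) (j : 'I_n) (gam : 'rV[R]_n.-1 -> R) (r : R),
    [/\ Q *m Q^T = 1%:M, lipschitz gam, 0 < r &
     forall y, ball x r y ->
       Omega y <-> gam (col' j (y *m Q)) < (y *m Q) 0 j].

Definition bounded_lipschitz_domain Omega :=
  [/\ Omega !=set0, open Omega, connected Omega, bounded_set Omega &
     lipschitz_boundary Omega].

End domains.

Section sobolev.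
Context (R : realType) (n : nat) (Omega : set 'rV[R]_n).
Implicit Types (u v f g phi : 'rV[R]_n -> R) (s : seq 'I_n) (m k : nat).

Local Notation leb := (lebesgue_rV R n).

Definition pderiv (i : 'I_n) u : 'rV[R]_n -> R :=
  fun x => 'D_(delta_mx 0 i) u x.

(* A list of indices stands for a multi-index of order its size. *)
Definition pderivs s u : 'rV[R]_n -> R := foldr pderiv u s.

Definition smooth u := forall s,
  continuous (pderivs s u) /\
  forall i x, derivable (pderivs s u) x (delta_mx 0 i).

Definition test_fun phi :=
  let supp := closure [set x | phi x != 0] in
  [/\ smooth phi, compact supp & supp `<=` Omega].

(* Square-integrable representatives: functions are total, only their values
   almost everywhere on Omega matter. *)
Definition L2 u :=
  measurable_fun Omega u /\ leb.-integrable Omega (fun x => (u x ^+ 2)%:E).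

Definition is_wderiv s u v := forall phi, test_fun phi ->
  \int[leb]_(x in Omega) (u x * pderivs s phi x) =
  (-1) ^+ size s * \int[leb]_(x in Omega) (v x * phi x).

(* A chosen representative of the weak derivative in L^2, if there is one *)
Definition wderiv s u : 'rV[R]_n -> R :=
  xget (cst 0) [set v | L2 v /\ is_wderiv s u v].

Definition sobolev m u :=
  L2 u /\ forall s, (size s <= m)%N -> exists v, L2 v /\ is_wderiv s u v.

(* Each multi-index is counted once per ordering, giving an equivalent norm. *)
Definition sobolev_norm m u : R :=
  Num.sqrt (\sum_(k < m.+1) \sum_(s : k.-tuple 'I_n)
    \int[leb]_(x in Omega) (wderiv s u x ^+ 2)).

Definition sobolev0 m u := sobolev m u /\
  forall e : R, 0 < e ->
    exists phi, test_fun phi /\ sobolev_norm m (u \- phi) < e.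

Definition wlap u : 'rV[R]_n -> R := fun x => \sum_i wderiv [:: i; i] u x.

Definition ip m u v : R :=
  let du := iter m./2 wlap u in
  let dv := iter m./2 wlap v in
  if odd m then
    \int[leb]_(x in Omega) (\sum_i wderiv [:: i] du x * wderiv [:: i] dv x)
  else \int[leb]_(x in Omega) (du x * dv x).

Definition norm0 m u : R := Num.sqrt (ip m u u).

Definition vcomp (v : 'rV[R]_n -> 'rV[R]_n) (j : 'I_n) : 'rV[R]_n -> R :=
  fun x => v x 0 j.

Definition vsobolev0 m (v : 'rV[R]_n -> 'rV[R]_n) :=
  forall j, sobolev0 m (vcomp v j).

Definition vnorm0 m (v : 'rV[R]_n -> 'rV[R]_n) : R :=
  Num.sqrt (\sum_j ip m (vcomp v j) (vcomp v j)).

Definition wdiv (v : 'rV[R]_n -> 'rV[R]_n) : 'rV[R]_n -> R :=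
  fun x => \sum_j wderiv [:: j] (vcomp v j) x.

Definition Xspace m f := sobolev0 m f /\ \int[leb]_(x in Omega) f x = 0.

Definition bogovskii m : \bar R :=
  ereal_sup [set ereal_inf [set (vnorm0 m.+1 v ^+ 2)%:E |
      v in [set v | vsobolev0 m.+1 v /\ ae_eq leb Omega (wdiv v) f]] |
    f in [set f | Xspace m f /\ norm0 m f = 1]].

Definition depends_only_on (i : 'I_n) g :=
  exists h : R -> R, forall x, Omega x -> g x = h (x 0 i).

(* Weak solution of (-Delta)^m w = g in Omega with w in H^m_0(Omega) *)
Definition polyharmonic_sol m g w := sobolev0 m w /\
  forall phi, sobolev0 m phi ->
    ip m w phi = \int[leb]_(x in Omega) (g x * phi x).

End sobolev.

(* Main.v *)
Require Import Defs.
From mathcomp Require Import all_boot all_order all_algebra.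
From mathcomp Require Import all_classical all_reals all_analysis.
From mathcomp Require Import measurable_realfun ring lra.
Import Order.TTheory GRing.Theory Num.Theory.
Import numFieldNormedType.Exports.
Local Open Scope classical_set_scope.
Local Open Scope ring_scope.

(**
Write (u, v)_m for the scalar product ip m. For a test function u, integrating by parts and
commuting derivatives gives the identity sum_i |d_i u|_m^2 = |u|_(m+1)^2.

The second claim is a duality computation. Let w solve (-Delta)^(m+1) w = g with g depending on
x_i only, and take f = d_i w / |d_i w|_m, which has mean zero and norm one. If v is any field of
H^(m+1)_0 with div v = f, then v_i and w / |d_i w|_m have the same integral against every function
of x_i: both fields v and w e_i / |d_i w|_m have divergence f, and the difference of two such
fields has no flux through the hyperplanes x_i = const. Hence
(w, v_i)_(m+1) = int g v_i = int g w / |d_i w|_m = |w|_(m+1)^2 / |d_i w|_m, and the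
Cauchy-Schwarz inequality gives |v|^2 >= |v_i|^2 >= |w|_(m+1)^2 / |d_i w|_m^2
(bogovskii_ge_solution), which exceeds n under the hypothesis.

The absence of flux (dot_one_variable_eq0) needs some care, because a primitive of g may fail to
be square integrable on Omega. The divergence theorem is applied only to smooth functions of x_i
whose derivatives increase to the indicator of a half-space (ramp); a monotone class argument
then passes to all Borel sets of values of x_i, and a simple-function approximation to g.

For the bound C_B >= n (bogovskii_ge_dim) no solution of a boundary value problem is constructed.
Let l be the supremum of (int phi)^2 / |phi|_(m+1)^2 over test functions, which is finite by the
Poincare inequality and positive. Take a nearly optimal phi, and by the identity above an index i
with |d_i phi|_m^2 <= |phi|_(m+1)^2 / n. If div v = f = d_i phi / |d_i phi|_m, integrating x_i
against f gives int v_i = int phi / |d_i phi|_m, and by density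
|v|^2 >= |v_i|^2 >= (int v_i)^2 / l, which is nearly |phi|_(m+1)^2 / |d_i phi|_m^2 >= n.
This is the first argument with g = 1, where the equation for w is replaced by its variational
characterization.

These arguments rest on facts about weak derivatives proved from the definitions: a smooth bump
function (flat_exp), symmetry of second derivatives (pderivC), the vanishing of the integral of a
derivative of a test function by Fubini (integral_pderiv_eq0), the fundamental lemma of the
calculus of variations (dot_test_eq0_ae), and hence uniqueness of weak derivatives. Statements
about H^m_0 are reduced to test functions by density (sobolev0_close).
*)

Set Implicit Arguments.
Unset Strict Implicit.
Unset Printing Implicit Defensive.

(** * Functions with continuous iterated directional derivatives *)

Section Ck.
Context (R : realType) (V : normedModType R) (I : Type) (d : I -> V).
Implicit Types (u v : V -> R).

(** Differentiability is asked only along the directions d i. With one direction this is the usual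
class C^N on the line; with the coordinate directions it characterizes smoothness on R^n. *)
Fixpoint Ck (N : nat) u : Prop :=
  continuous u /\
  if N is N'.+1 then
    forall i, exists2 v, forall x, is_derive x (d i) u (v x) & Ck N' v
  else True.

Lemma Ck_continuous N u : Ck N u -> continuous u.
Proof. by case: N => [|N] []. Qed.

Lemma CkS N u : Ck N.+1 u -> Ck N u.
Proof.
elim: N u => [|N IH] u [cu du]; split=> // i.
by have [v dv Cv] := du i; exists v => //; exact: IH.
Qed.

Lemma Ck_cst N c : Ck N (cst c).
Proof.
elim: N c => [|N IH] c; split=> //; try exact: cst_continuous.
by move=> i; exists (cst 0) => // x; exact: is_derive_cst.
Qed.

Lemma CkD N u v : Ck N u -> Ck N v -> Ck N (u \+ v).
Proof.
elim: N u v => [|N IH] u v Cu Cv.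
  by split=> // x; apply: cvgD; [exact: (Ck_continuous Cu)|exact: (Ck_continuous Cv)].
split=> [x|i]; first by apply: cvgD; [exact: (Ck_continuous Cu)|exact: (Ck_continuous Cv)].
have [_ /(_ i)[u' du Cu']] := Cu; have [_ /(_ i)[v' dv Cv']] := Cv.
by exists (u' \+ v') => [x|]; [exact: is_deriveD|exact: IH].
Qed.

Lemma CkM N u v : Ck N u -> Ck N v -> Ck N (u \* v).
Proof.
elim: N u v => [|N IH] u v Cu Cv.
  by split=> // x; apply: cvgM; [exact: (Ck_continuous Cu)|exact: (Ck_continuous Cv)].
split=> [x|i]; first by apply: cvgM; [exact: (Ck_continuous Cu)|exact: (Ck_continuous Cv)].
have [_ /(_ i)[u' du Cu']] := Cu; have [_ /(_ i)[v' dv Cv']] := Cv.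
exists ((u \* v') \+ (v \* u')) => [x|].
  exact: is_deriveM.
by apply: CkD; apply: IH => //; exact: CkS.
Qed.

End Ck.

(** * A flat function *)

Section bump.
Context (R : realType).
Implicit Types (t : R) (k : nat).

(** The function t^(-k) exp(-1/t), extended by 0 to t <= 0. The derivative of one of them is a
combination of the next two, so that all of them are infinitely differentiable. *)
Definition flat_exp k t : R :=
  if 0 < t then t^-1 ^+ k * expR (- t^-1) else 0.

Lemma flat_exp_ge0 k t : 0 <= flat_exp k t.
Proof.
by rewrite /flat_exp; case: ifPn => // t0; rewrite mulr_ge0 ?exprn_ge0 ?invr_ge0 ?expR_ge0 ?ltW.
Qed.

(** This linear bound makes every flat_exp k flat at 0: it is the inequality y^(k+1) <= (k+1)! exp y
at y = 1/t. *)
Lemma flat_exp_le k t : flat_exp k t <= (k.+1)`!%:R * `|t|.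
Proof.
rewrite /flat_exp; case: ifPn => [t0|_]; last by rewrite mulr_ge0.
rewrite gtr0_norm// expRN.
have y0 : 0 < t^-1 by rewrite invr_gt0.
have /(le_trans _) := expR_ge1Dxn k (ltW y0) => /(_ _ (ler_wpDl ler01 (lexx _))) h.
rewrite ler_pdivrMr ?expR_gt0//.
have f0 : 0 < (k.+1)`!%:R :> R by rewrite ltr0n fact_gt0.
rewrite ler_pdivrMr// in h.
have -> : t^-1 ^+ k = t * t^-1 ^+ k.+1 by rewrite exprS mulVKf// gt_eqF.
by rewrite -mulrA [leRHS]mulrCA ler_pM2l// mulrC.
Qed.

Lemma flat_exp_divt k t : t^-1 * flat_exp k t = flat_exp k.+1 t.
Proof. by rewrite /flat_exp; case: ifPn => _; rewrite ?mulr0// mulrA exprS. Qed.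

Lemma flat_exp_is_derive k t :
  is_derive t 1 (flat_exp k) (flat_exp k.+2 t - k%:R * flat_exp k.+1 t).
Proof.
have [t0|t0|->] := ltgtP t 0.
- rewrite /flat_exp !ltNge (ltW t0)/= mulr0 subr0.
  apply: (@near_eq_is_derive _ _ _ (cst 0)).
  near=> s; rewrite ifF//; apply/negbTE; rewrite -leNgt ltW//.
  by near: s; exact: lt_nbhsl.
- apply: (@near_eq_is_derive R R^o R^o (fun s : R => s^-1 ^+ k * expR (- s^-1))).
  + by near=> s; rewrite /flat_exp ifT//; near: s; exact: lt_nbhsr.
  + have tn0 : t != 0 by rewrite gt_eqF.
    have dV : is_derive t 1 (fun s : R => s^-1) (- t ^- 2).
      have := @is_deriveV R id t 1 1 tn0 (is_derive_id _ _).
      by rewrite [_ *: _]mulr1.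
    have dE : is_derive t 1 (fun s : R => expR (- s^-1)) (t ^- 2 * expR (- t^-1)).
      have dN := is_deriveN dV.
      have := @is_derive1_comp _ (@expR R) _ t _ _ (is_derive_expR _) dN.
      by rewrite opprK mulrC; apply.
    have := is_deriveM (is_deriveX k dV) dE.
    have -> : (fun s : R => s^-1) ^+ k * (fun s => expR (- s^-1)) =
              (fun s : R => s^-1 ^+ k * expR (- s^-1)).
      by apply/funext => s; rewrite exprfctE.
    move/is_derive_eq; apply.
    rewrite /flat_exp t0 /GRing.scale/= !exprfctE/= -!exprVn.
    case: k => [|k]/=; first by rewrite !mul0r mulr0 !expr0; ring.
    by rewrite !exprS; ring.
- rewrite /flat_exp ltxx mulr0 subr0.
  (* At 0 the difference quotient at h is flat_exp k.+1 h, of size O(|h|). *)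
  suff H : h^-1 *: ((flat_exp k \o shift 0) (h *: 1) - flat_exp k 0) @[h --> 0^'] --> (0:R).
    by split; [apply/cvg_ex; exists 0|exact/cvg_lim].
  apply/cvgrPdist_le => e e0.
  have f0 : 0 < (k.+2)`!%:R :> R by rewrite ltr0n fact_gt0.
  near=> h; rewrite sub0r normrN /= /flat_exp ltxx subr0 -/(flat_exp k _).
  rewrite addr0 /GRing.scale/= mulr1 flat_exp_divt ger0_norm ?flat_exp_ge0//.
  rewrite (le_trans (flat_exp_le _ _))// -ler_pdivlMl// mulrC.
  near: h; apply: dnbhs0_le; exact: divr_gt0.
Unshelve. all: by end_near. Qed.

End bump.

(** Reduces directional derivatives to one-variable calculus. *)
Lemma is_derive_lineP (R : realType) (V : normedModType R) (f : V -> R)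
    (x v : V) (h : R) (df : R) :
  is_derive h 1 (fun s : R => f (s *: v + x)) df <->
  is_derive (h *: v + x) v f df.
Proof.
set g := fun s : R => f (s *: v + x).
have E (k : R) : k^-1 *: ((g \o shift h) (k *: 1) - g h) =
    k^-1 *: ((f \o shift (h *: v + x)) (k *: v) - f (h *: v + x)).
  by rewrite /= /g [k *: 1]mulr1 scalerDl addrA.
have E1 : derivable g h 1 = derivable f (h *: v + x) v.
  by rewrite /derivable; under [X in X @ _]funext do rewrite E.
have E2 : 'D_1 g h = 'D_v f (h *: v + x).
  by rewrite /derive; under [X in X @ _]funext do rewrite E.
by split=> -[H1 H2]; split; [rewrite -E1|rewrite -E2|rewrite E1|rewrite E2].
Qed.

(** * Smooth functions on row vectors *)

Section Ck_affine.
Context (R : realType) (V : normedModType R) (I : Type) (d : I -> V).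

Lemma Ck_affine_comp N (c : R -> R) (L : V -> R) (a : I -> R) :
  continuous L -> (forall i h x, L (h *: d i + x) = h * a i + L x) ->
  Ck (fun _ : unit => 1 : R) N c -> Ck d N (c \o L).
Proof.
move=> cL Ld; elim: N c => [|N IH] c Cc.
  split=> // x; apply: continuous_comp; [exact: cL|exact: (Ck_continuous Cc)].
split=> [x|i].
  apply: continuous_comp; [exact: cL|exact: (Ck_continuous Cc)].
have [_ /(_ tt)[c' dc Cc']] := Cc.
exists (cst (a i) \* (c' \o L)); last by apply: CkM; [exact: Ck_cst|exact: IH].
move=> x; suff : is_derive (0 *: d i + x) (d i) (c \o L) ((cst (a i) \* (c' \o L)) x).
  by rewrite scale0r add0r.
apply/is_derive_lineP => /=.
rewrite (_ : (fun s => _) = (fun s : R => c (s * a i + L x))); last first.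
  by apply/funext => s; rewrite Ld.
have dA : is_derive (0:R) 1 (fun s : R => s * a i + L x) (a i).
  have := is_deriveD (is_deriveM (is_derive_id (0:R) 1) (is_derive_cst (a i) (0:R) 1))
    (is_derive_cst (L x) (0:R) 1).
  by rewrite scaler0 add0r addr0 [_ *: _]mulr1; apply.
have dC : is_derive ((fun s : R => s * a i + L x) 0) 1 c (c' (L x)).
  by rewrite mul0r add0r.
by have := @is_derive1_comp _ c (fun s : R => s * a i + L x) 0 _ _ dC dA; rewrite mulrC.
Qed.

End Ck_affine.

Section bumpCk.
Context (R : realType).

Lemma flat_exp_Ck N k : Ck (fun _ : unit => 1 : R) N (@flat_exp R k).
Proof.
have c j : continuous (@flat_exp R j).
  move=> t; apply: differentiable_continuous; apply/derivable1_diffP.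
  by have [] := flat_exp_is_derive j t.
elim: N k => [|N IH] k; split=> // _.
exists (flat_exp k.+2 \+ cst (- k%:R) \* flat_exp k.+1) => [t|].
  by rewrite /= mulNr; exact: flat_exp_is_derive.
by apply: CkD => //; apply: CkM => //; exact: Ck_cst.
Qed.

Lemma id_Ck N : Ck (fun _ : unit => 1 : R) N (@id R).
Proof.
case: N => [|N]; split=> //; try by move=> x; exact: cvg_id.
by move=> _; exists (cst 1) => [t|]; [exact: is_derive_id|exact: Ck_cst].
Qed.

End bumpCk.

Section smooth.
Context (R : realType) (n : nat).
Implicit Types (u v : 'rV[R]_n -> R) (i : 'I_n) (s : seq 'I_n).

Let e (i : 'I_n) : 'rV[R]_n := delta_mx 0 i.

Lemma pderivs_rcons s i u : pderivs (rcons s i) u = pderivs s (pderiv i u).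
Proof. by rewrite /pderivs foldr_rcons. Qed.

Lemma is_derive_pderiv i u v : (forall x, is_derive x (e i) u (v x)) -> pderiv i u = v.
Proof. by move=> h; apply/funext => x; have [_] := h x. Qed.

Lemma smoothP u : smooth u <-> forall N, Ck e N u.
Proof.
split=> [su N|Cu s].
  elim: N u su => [|N IH] u su; first by split=> //; have [] := su [::].
  split=> [|i]; first by have [] := su [::].
  exists (pderiv i u).
    by move=> x; split=> //; have [_] := su [::]; exact.
  by apply: IH => s; rewrite -pderivs_rcons; exact: su.
(* Ck consumes the innermost derivative first, that is, the last index of s. *)
elim/last_ind: s u Cu => [|s i IH] u Cu.
  split=> [|i x]; first exact: (Ck_continuous (Cu 0%N)).
  by have [_ /(_ i)[v /(_ x)[]]] := Cu 1%N.
rewrite pderivs_rcons; apply: IH => N.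
have [_ /(_ i)[v dv Cv]] := Cu N.+1.
by rewrite (is_derive_pderiv dv).
Qed.

Lemma smooth_continuous u : smooth u -> continuous u.
Proof. by move=> /(_ [::])[]. Qed.

Lemma smooth_is_derive i u x : smooth u -> is_derive x (e i) u (pderiv i u x).
Proof. by move=> su; split=> //; have [_] := su [::]; exact. Qed.

Lemma smooth_pderiv i u : smooth u -> smooth (pderiv i u).
Proof. by move=> su s; rewrite -pderivs_rcons; exact: su. Qed.

Lemma smooth_pderivs s u : smooth u -> smooth (pderivs s u).
Proof. by move=> su; elim: s => [|i s IH]; [exact: su|exact: (smooth_pderiv i IH)]. Qed.

Lemma smooth_cst (c : R) : smooth (cst c : 'rV[R]_n -> R).
Proof. by apply/smoothP => N; exact: Ck_cst. Qed.

Lemma smoothD u v : smooth u -> smooth v -> smooth (u \+ v).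
Proof. by move=> /smoothP Cu /smoothP Cv; apply/smoothP => N; exact: CkD. Qed.

Lemma smoothM u v : smooth u -> smooth v -> smooth (u \* v).
Proof. by move=> /smoothP Cu /smoothP Cv; apply/smoothP => N; exact: CkM. Qed.

Lemma smooth_sum (J : Type) (r : seq J) (u : J -> 'rV[R]_n -> R) :
  (forall j, smooth (u j)) -> smooth (fun x => \sum_(j <- r) u j x).
Proof.
move=> su; elim: r => [|j r IH].
  by rewrite (_ : (fun x => _) = cst 0); [exact: smooth_cst|apply/funext => x; rewrite big_nil].
rewrite (_ : (fun x => _) = u j \+ (fun x => \sum_(k <- r) u k x)).
  exact: (smoothD (su j) IH).
by apply/funext => x; rewrite big_cons.
Qed.

Lemma smooth_prod (J : Type) (r : seq J) (u : J -> 'rV[R]_n -> R) :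
  (forall j, smooth (u j)) -> smooth (fun x => \prod_(j <- r) u j x).
Proof.
move=> su; elim: r => [|j r IH].
  by rewrite (_ : (fun x => _) = cst 1); [exact: smooth_cst|apply/funext => x; rewrite big_nil].
rewrite (_ : (fun x => _) = u j \* (fun x => \prod_(k <- r) u k x)).
  exact: (smoothM (su j) IH).
by apply/funext => x; rewrite big_cons.
Qed.

Lemma pderivD i u v : smooth u -> smooth v -> pderiv i (u \+ v) = pderiv i u \+ pderiv i v.
Proof.
by move=> su sv; apply: is_derive_pderiv => x; apply: is_deriveD; exact: smooth_is_derive.
Qed.

Lemma pderivM i u v : smooth u -> smooth v ->
  pderiv i (u \* v) = (fun x => u x * pderiv i v x + v x * pderiv i u x).
Proof.
by move=> su sv; apply: is_derive_pderiv => x; apply: is_deriveM; exact: smooth_is_derive.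
Qed.

Lemma pderiv_cst i (c : R) : pderiv i (cst c) = cst 0.
Proof. by apply: is_derive_pderiv => x; exact: is_derive_cst. Qed.

Lemma pderivZ i (c : R) u : smooth u -> pderiv i (fun x => c * u x) = (fun x => c * pderiv i u x).
Proof.
move=> su; rewrite [LHS](pderivM i (smooth_cst c) su).
by apply/funext => x; rewrite pderiv_cst /= mulr0 addr0.
Qed.

Lemma pderiv_sum i (J : Type) (r : seq J) (u : J -> 'rV[R]_n -> R) :
  (forall j, smooth (u j)) ->
  pderiv i (fun x => \sum_(j <- r) u j x) = (fun x => \sum_(j <- r) pderiv i (u j) x).
Proof.
move=> su; elim: r => [|j r IH].
  rewrite [X in pderiv i X](_ : _ = cst 0); last by apply/funext => x; rewrite big_nil.
  by rewrite pderiv_cst; apply/funext => x; rewrite big_nil.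
rewrite [X in pderiv i X](_ : _ = u j \+ (fun x => \sum_(k <- r) u k x)); last first.
  by apply/funext => x; rewrite big_cons.
rewrite pderivD//; last exact: smooth_sum.
by rewrite IH; apply/funext => x; rewrite big_cons.
Qed.

Lemma smooth_affine_comp (c : R -> R) (j : 'I_n) (l b : R) :
  (forall N, Ck (fun _ : unit => 1 : R) N c) -> smooth (fun x => c (l * x 0 j + b)).
Proof.
move=> Cc; apply/smoothP => N.
have cL : continuous (fun x : 'rV[R]_n => l * x 0 j + b).
  have cc := @coord_continuous R 1 n 0 j.
  by move=> x; exact: (cvgD (cvgM (cvg_cst l) (cc x)) (cvg_cst b)).
have aL (i : 'I_n) h (x : 'rV[R]_n) :
    l * (h *: e i + x) 0 j + b = h * (l * (i == j)%:R) + (l * x 0 j + b).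
  by rewrite !mxE eqxx eq_sym /=; ring.
exact: (Ck_affine_comp cL aL (Cc N)).
Qed.

Lemma pderiv_coord_comp i (c c' : R -> R) (j : 'I_n) :
  (forall t : R, is_derive t 1 c (c' t)) ->
  pderiv i (fun x => c (x 0 j)) = (fun x => (i == j)%:R * c' (x 0 j)).
Proof.
move=> dc; apply: is_derive_pderiv => x.
suff : is_derive (0 *: e i + x) (e i) (fun y => c (y 0 j)) ((i == j)%:R * c' (x 0 j)).
  by rewrite scale0r add0r.
apply/is_derive_lineP => /=.
rewrite (_ : (fun h => _) = (fun h : R => c (h * (j == i)%:R + x 0 j))); last first.
  by apply/funext => h; rewrite !mxE eqxx.
rewrite [j == i]eq_sym; case: eqP => _ /=; last first.
  rewrite mul0r (_ : (fun h => _) = cst (c (x 0 j))); first exact: is_derive_cst.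
  by apply/funext => h; rewrite mulr0 add0r.
rewrite mul1r -[X in is_derive _ _ _ X]mulr1.
apply: (@is_derive1_comp _ c (fun h : R => h * 1 + x 0 j)); first by rewrite mul0r add0r.
have := is_deriveD (is_derive_id (0:R) 1) (is_derive_cst (x 0 j) (0:R) 1).
rewrite addr0 (_ : id + cst (x 0 j) = fun h : R => h * 1 + x 0 j)//.
by apply/funext => h; rewrite mulr1.
Qed.

End smooth.

(** * Symmetry of second derivatives *)

Section schwarz.
Context (R : realType) (n : nat).
Implicit Types (u v : 'rV[R]_n -> R) (i j : 'I_n) (x : 'rV[R]_n).

Let e (i : 'I_n) : 'rV[R]_n := delta_mx 0 i.

Lemma smooth_line_is_derive i u x (h : R) : smooth u ->
  is_derive h 1 (fun s : R => u (s *: e i + x)) (pderiv i u (h *: e i + x)).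
Proof. by move=> su; apply/is_derive_lineP; exact: smooth_is_derive. Qed.

Lemma derive_continuous (f df : R -> R) :
  (forall h : R, is_derive h 1 f (df h)) -> continuous f.
Proof.
move=> d h; apply: differentiable_continuous; apply/derivable1_diffP.
by have [] := d h.
Qed.

Lemma derive_MVT0 (f df : R -> R) (h : R) : 0 < h ->
  (forall s : R, is_derive s 1 f (df s)) ->
  exists2 s, 0 <= s <= h & f h - f 0 = h * df s.
Proof.
move=> h0 d.
have cf := continuous_subspaceT (derive_continuous d).
have [s + ->] := MVT h0 (fun s _ => d s) (cf `[0, h]%classic).
rewrite in_itv/= => /andP[s0 sh].
by exists s; rewrite ?(ltW s0) ?(ltW sh)// subr0 mulrC.
Qed.

(** Two applications of the mean value theorem to the second difference over a square of side h.
The second difference is symmetric in i and j, the right-hand side is not: this is what proves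
the symmetry of mixed derivatives. *)
Lemma mixed_difference i j u x (h : R) : smooth u -> 0 < h ->
  exists s t, [/\ 0 <= s <= h, 0 <= t <= h &
  u (h *: e i + (h *: e j + x)) - u (h *: e i + x) - (u (h *: e j + x) - u x) =
  h * (h * pderiv j (pderiv i u) (t *: e j + (s *: e i + x)))].
Proof.
move=> su h0.
have dp (s : R) : is_derive s 1
    (fun s : R => u (s *: e i + (h *: e j + x)) - u (s *: e i + x))
    (pderiv i u (s *: e i + (h *: e j + x)) - pderiv i u (s *: e i + x)).
  by apply: is_deriveB; exact: smooth_line_is_derive.
have [s s0h] := derive_MVT0 h0 dp; rewrite !scale0r !add0r => ->.
have dq (t : R) : is_derive t 1 (fun t : R => pderiv i u (t *: e j + (s *: e i + x)))
    (pderiv j (pderiv i u) (t *: e j + (s *: e i + x))).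
  exact/smooth_line_is_derive/smooth_pderiv.
have [t t0h] := derive_MVT0 h0 dq; rewrite !scale0r !add0r => E.
by exists s, t; split=> //; rewrite -E [s *: e i + (_ + x)]addrCA.
Qed.

Lemma pderivC i j u : smooth u -> pderiv i (pderiv j u) = pderiv j (pderiv i u).
Proof.
move=> su; apply/funext => x; apply/eqP; rewrite -subr_eq0 -normr_le0.
apply/ler_addgt0Pl => eps eps0; rewrite addr0.
have near_x (v : 'rV[R]_n -> R) : smooth v ->
    exists2 r : R, 0 < r & forall y, `|x - y| < r -> `|v x - v y| < eps / 2.
  move=> sv; have /cvgrPdist_lt/(_ (eps / 2)) := @smooth_continuous _ _ v sv x.
  rewrite divr_gt0// => /(_ isT)/nbhs_ballP[r r0 H]; exists r => // y xy.
  by apply: H; rewrite mx_norm_ball.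
have [r1 r10 H1] := near_x _ (smooth_pderiv j (smooth_pderiv i su)).
have [r2 r20 H2] := near_x _ (smooth_pderiv i (smooth_pderiv j su)).
pose r := Num.min r1 r2.
have r0 : 0 < r by rewrite lt_min r10.
pose h := r / (`|e i| + `|e j| + 1).
have D0 : 0 < `|e i| + `|e j| + 1 by rewrite ltr_wpDl// addr_ge0.
have h0 : 0 < h by rewrite divr_gt0.
have close k l s t : `|e k| + `|e l| = `|e i| + `|e j| -> 0 <= s <= h -> 0 <= t <= h ->
    `|x - (t *: e l + (s *: e k + x))| < r.
  move=> kl /andP[s0 sh] /andP[t0 th].
  rewrite addrA opprD addrCA subrr addr0 normrN (le_lt_trans (ler_normD _ _))//.
  rewrite !normrZ !ger0_norm// (@le_lt_trans _ _ (h * (`|e i| + `|e j|)))//.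
    by rewrite -kl mulrDr addrC lerD// ler_wpM2r.
  by rewrite -[ltRHS](@divfK _ (`|e i| + `|e j| + 1)) ?gt_eqF// ltr_pM2l// ltrDl.
have [s [t [sh th E1]]] := mixed_difference i j x su h0.
have [s' [t' [sh' th' E2]]] := mixed_difference j i x su h0.
have /H1 a1 : `|x - (t *: e j + (s *: e i + x))| < r1.
  by rewrite (lt_le_trans (close _ _ _ _ _ sh th))// ge_min lexx.
have /H2 a2 : `|x - (t' *: e i + (s' *: e j + x))| < r2.
  by rewrite (lt_le_trans (close _ _ _ _ _ sh' th')) 1?addrC// ge_min lexx orbT.
(* Both mixed derivatives take the same value at two points close to x. *)
have E : pderiv j (pderiv i u) (t *: e j + (s *: e i + x)) =
         pderiv i (pderiv j u) (t' *: e i + (s' *: e j + x)).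
  have hn0 : h != 0 by rewrite gt_eqF.
  apply: (mulfI hn0); apply: (mulfI hn0).
  apply: etrans (esym E1) _; apply: etrans _ E2.
  rewrite [h *: e i + (_ + x)]addrCA.
  move: (u (h *: e i + x)) (u (h *: e j + x)) (u x) (u (_ + (_ + _))) => b c d f.
  by ring.
rewrite E in a1.
move: a1 a2; set A := pderiv _ _ x; set B := pderiv _ _ x; set C := pderiv _ _ _.
clearbody A B C => a1 a2.
rewrite (_ : B - A = (B - C) - (A - C)); last by ring.
apply: (le_trans (ler_normB _ _)); rewrite (splitr eps).
apply: lerD; first exact: (ltW a2).
exact: (ltW a1).
Qed.

End schwarz.

(** * Test functions *)

Lemma coord_le_norm (R : realType) n (x : 'rV[R]_n) j : `|x 0 j| <= `|x|.
Proof.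
rewrite [leRHS]mx_normrE.
exact: (le_bigmax _ (fun i : 'I_1 * 'I_n => `|x i.1 i.2|) (0, j)).
Qed.

Section test_functions.
Context (R : realType) (n : nat) (Omega : set 'rV[R]_n).
Implicit Types (u v phi : 'rV[R]_n -> R) (i : 'I_n) (s : seq 'I_n).

Let test := @test_fun R n Omega.

Lemma test_smooth phi : test phi -> smooth phi. Proof. by case. Qed.

Lemma test_out phi x : test phi -> ~ Omega x -> phi x = 0.
Proof.
move=> [_ _ sO] nOx; apply/eqP; apply: contra_notT nOx => px.
by apply: sO; exact: subset_closure.
Qed.

(** Smooth functions supported in the support of a test function are test functions; this gives all
closure properties used below. *)
Lemma test_sub phi v : test phi -> smooth v ->
  (forall x, v x != 0 -> closure [set x | phi x != 0] x) -> test v.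
Proof.
move=> [sp cp pO] sv vp.
have sub : closure [set x | v x != 0] `<=` closure [set x | phi x != 0].
  rewrite [X in _ `<=` X](closure_id _).1; last exact: closed_closure.
  exact: closureS.
split=> //; last exact: subset_trans pO.
apply: subclosed_compact cp sub; exact: closed_closure.
Qed.

Lemma pderiv_support i u x : pderiv i u x != 0 -> closure [set x | u x != 0] x.
Proof.
move=> px B Bx; apply: contrapT => uB.
case/eqP: px; rewrite /pderiv.
have := @near_eq_derive R _ _ (cst 0) u x (delta_mx 0 i).
rewrite derive_cst => <-//.
near=> y; apply/esym/eqP; apply: contra_notT uB => uy.
by exists y; split=> //; near: y; exact: Bx.
Unshelve. all: by end_near. Qed.

Lemma test_pderiv i phi : test phi -> test (pderiv i phi).
Proof.
move=> tp; apply: (test_sub tp); first by apply: smooth_pderiv; exact: test_smooth.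
exact: pderiv_support.
Qed.

Lemma test_pderivs s phi : test phi -> test (pderivs s phi).
Proof. by move=> tp; elim: s => [//|i s IH]; exact: (test_pderiv i IH). Qed.

Lemma test_mul u phi : smooth u -> test phi -> test (u \* phi).
Proof.
move=> su tp; apply: (test_sub tp); first exact: (smoothM su (test_smooth tp)).
move=> x; rewrite /= mulf_eq0 negb_or => /andP[_ px]; exact: subset_closure.
Qed.

Lemma test_scale (c : R) phi : test phi -> test (fun x => c * phi x).
Proof.
move=> tp; have := test_mul (@smooth_cst R n c) tp.
exact.
Qed.

Lemma test_bounded phi : test phi ->
  exists M : R, forall x, phi x != 0 -> forall j, `|x 0 j| <= M.
Proof.
move=> [_ /compact_bounded[M [_ HM]] _].
exists (M + 1) => x px j.
have M1 : M < M + 1 by rewrite ltrDl.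
have cx : closure [set y | phi y != 0] x by exact: subset_closure.
have := HM (M + 1) M1 x cx.
by apply: le_trans; exact: coord_le_norm.
Qed.

End test_functions.

(** * Cubes, measurability and integrability *)

Section topology_rV.
Context (R : realType) (n : nat).
Implicit Types (x y : 'rV[R]_n) (A : set 'rV[R]_n) (f : 'rV[R]_n -> R).

(** Cubes with rational centre and radius 1/(k+1), indexed by the countable type of pairs (q, k),
replace a countable base of the topology. *)
Definition rat_center (p : 'rV[rat]_n * nat) (j : 'I_n) : R := ratr (p.1 0 j).

Definition rat_open_cube (p : 'rV[rat]_n * nat) : set 'rV[R]_n :=
  [set x | forall j, `|x 0 j - rat_center p j| < p.2.+1%:R^-1].

Definition rat_closed_cube (p : 'rV[rat]_n * nat) : set 'rV[R]_n :=
  [set x | forall j, `|x 0 j - rat_center p j| <= p.2.+1%:R^-1].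

Lemma rat_cube_subset p : rat_open_cube p `<=` rat_closed_cube p.
Proof. by move=> x xp j; exact/ltW/xp. Qed.

(** The closed cube is kept inside A so that bump functions of the open cube are supported in A. *)
Lemma rat_cube_cover A x : open A -> A x ->
  exists2 p, rat_open_cube p x & rat_closed_cube p `<=` A.
Proof.
move=> oA Ax.
have /nbhs_ballP[e /= e0 eA] : nbhs x A by exact: open_nbhs_nbhs.
have [k ke] : exists k, k.+1%:R^-1 < e / 2.
  have e2 : 0 < e / 2 by rewrite divr_gt0.
  by have [k _ /(_ k (leqnn k))] := near_infty_natSinv_lt (PosNum e2); exists k.
have rat_j j : exists q : rat, `|x 0 j - ratr q| < k.+1%:R^-1.
  have : ball (x 0 j) k.+1%:R^-1 `&` range (@ratr R) !=set0.
    apply: dense_rat; last by exact: ball_open.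
    by exists (x 0 j); apply: ballxx; rewrite invr_gt0.
  by move=> [y [xy [q _ qE]]]; exists q; rewrite qE.
have /choice[q xq] := rat_j.
exists (\row_j q j, k); first by move=> j; rewrite /rat_center mxE.
move=> y yk; apply: eA; split=> // i j; rewrite ord1 /ball/=.
have := yk j; rewrite /rat_center mxE /= => ykj.
rewrite (splitr e) -[x 0 j - y 0 j](subrKA (ratr (q j))) (le_lt_trans (ler_normD _ _))//.
by rewrite ltrD// ?(lt_trans (xq j))// distrC (le_lt_trans ykj).
Qed.

Lemma measurable_rat_open_cube p : measurable (rat_open_cube p).
Proof.
apply: (@measurable_rV_box R n (fun j => [set t | `|t - rat_center p j| < p.2.+1%:R^-1])) => j.
rewrite (_ : [set t | _] = ball (rat_center p j) (p.2.+1%:R^-1)).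
  exact: measurable_ball.
by apply/seteqP; split=> t; rewrite /ball/= distrC.
Qed.

(** The sigma-algebra is generated by the coordinates, hence contains cubes; an open set is a
countable union of them. *)
Lemma open_rV_measurable A : open A -> measurable A.
Proof.
move=> oA.
pose F p := if `[< rat_closed_cube p `<=` A >] then rat_open_cube p else set0.
rewrite (_ : A = \bigcup_p F p).
  apply: countable_bigcupT_measurable; first exact: countableP.
  by move=> p; rewrite /F; case: ifP => _ //; exact: measurable_rat_open_cube.
apply/seteqP; split=> [x Ax|x [p _]].
  have [p xp pA] := rat_cube_cover oA Ax.
  by exists p => //; rewrite /F asboolT.
by rewrite /F; case: asboolP => // pA px; apply: pA; exact: rat_cube_subset.
Qed.

Lemma continuous_rV_measurable f : continuous f -> measurable_fun setT f.
Proof.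
move=> /continuousP cf; apply: (measurability _ (RGenOpens.measurableE R)).
move=> _ [_ [a [b ->] <-]]; rewrite setTI; apply: open_rV_measurable.
exact/cf/interval_open.
Qed.

Definition cube (M : R) : set 'rV[R]_n := [set x | forall j, `|x 0 j| <= M].

Lemma cubeE M : cube M = [set x | forall j, `[- M, M]%classic (x 0 j)].
Proof. by apply/seteqP; split=> x xM j; have := xM j; rewrite /= in_itv/= ler_norml. Qed.

Lemma measurable_cube M : measurable (cube M).
Proof. by rewrite cubeE; apply: (@measurable_rV_box R n (fun=> `[- M, M]%classic)). Qed.

Lemma compact_cube M : compact (cube M).
Proof.
rewrite cubeE; apply: (@rV_compact R n (fun=> `[- M, M]%classic)) => _.
exact: segment_compact.
Qed.

Lemma cube_fin M : (lebesgue_rV R n (cube M) < +oo)%E.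
Proof.
rewrite cubeE (@lebesgue_rV_box R n (fun=> `[- M, M]%classic))//.
rewrite (eq_bigr (fun=> (Num.max 0 (M - - M))%:E)); last first.
  move=> j _; rewrite lebesgue_measure_itv/= lte_fin; case: ifPn => MM.
    by rewrite max_r ?EFinB// subr_ge0 ltW.
  by rewrite max_l// subr_le0 leNgt.
by rewrite prodEFin ltry.
Qed.

Lemma cube_supp_bounded f M : continuous f -> (forall x, f x != 0 -> cube M x) ->
  exists C, forall x, `|f x| <= C.
Proof.
move=> cf fM.
have /compact_bounded[C [_ HC]] : compact (f @` cube M).
  by apply: continuous_compact; [exact: continuous_subspaceT|exact: compact_cube].
exists `|C + 1| => x; have [->|fx] := eqVneq (f x) 0; first by rewrite normr0.
apply: HC; last by exists x => //; exact: fM.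
by rewrite (lt_le_trans _ (ler_norm _))// ltrDl.
Qed.

End topology_rV.

Lemma bounded_supp_integrable d (T : measurableType d) (R : realType)
    (mu : {measure set T -> \bar R}) (D : set T) (f : T -> R) (C : R) :
  measurable D -> (mu D < +oo)%E -> measurable_fun setT f ->
  (forall x, `|f x| <= C) -> (forall x, f x != 0 -> D x) ->
  mu.-integrable setT (EFin \o f).
Proof.
move=> mD Dfin mf fC fD.
rewrite (_ : EFin \o f = (EFin \o f) \_ D); last first.
  apply/funext => x; rewrite /patch; case: ifPn => //.
  by rewrite notin_setE => nDx; rewrite /= (contra_notP (fun h => fD x (introN eqP h)) nDx).
apply: (iffLR (integrable_mkcond _ mD)).
apply: measurable_bounded_integrable => //.
  exact: measurable_funTS.
exists C; split; first by rewrite num_real.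
by move=> M CM x _; exact/(le_trans (fC x))/ltW.
Qed.

(** * The integral of a partial derivative *)

Section integral_derivative.
Context (R : realType).

Lemma integral_derive1_eq0 (F f : R -> R) M : (forall t : R, is_derive t 1 F (f t)) ->
  continuous f -> (forall t, F t != 0 -> `|t| <= M) ->
  (\int[@lebesgue_measure R]_t (f t)%:E = 0)%E.
Proof.
move=> dF cf FM.
have cF := derive_continuous dF.
pose N := `|M| + 1.
have FN t : N <= `|t| -> F t = 0.
  move=> Nt; apply/eqP; apply: contraTT Nt => /FM tM.
  by rewrite -ltNge (le_lt_trans tM)// (le_lt_trans (ler_norm _))// ltrDl.
have f0 t : N < `|t| -> f t = 0.
  move=> Nt; have [_ <-] := dF t.
  rewrite -(@near_eq_derive R R^o R^o (cst 0)) ?derive_cst//.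
  have : \forall s \near t, N < `|s|.
    exact: (@cvgr_gt _ _ _ _ (fun s : R => `|s|) `|t| (@norm_continuous _ R^o t) N Nt).
  by apply: filterS => s Ns; rewrite FN// ltW.
have N0 : 0 < N by rewrite ltr_wpDl.
have NN : - N < N by rewrite gtrN.
rewrite (_ : (fun t => (f t)%:E) = (fun t => (f t)%:E) \_ `[- N, N]); last first.
  apply/funext => t; rewrite /patch; case: ifPn => //.
  rewrite notin_setE/= in_itv/= => /negP; rewrite -ler_norml -ltNge => /f0 ->//.
rewrite -integral_mkcond (@continuous_FTC2 _ _ F)//.
- by rewrite !FN ?subee// ?normrN ?gtr0_norm.
- exact: continuous_subspaceT.
- split; first by move=> t _; have [] := dF t.
  + exact/cvg_at_right_filter/cF.
  + exact/cvg_at_left_filter/cF.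
- by move=> t _; rewrite derive1E; have [_ ->] := dF t.
Qed.

Lemma rV_consE n (h a : R) (y : 'rV[R]_n) :
  rV_cons (h + a, y) = h *: delta_mx 0 ord0 + rV_cons (a, y).
Proof.
apply/rowP => k; rewrite !mxE eqxx /=; case: (unliftP ord0 k) => [j ->|->].
  by rewrite eq_sym (negbTE (neq_lift ord0 j)) mulr0 add0r.
by rewrite eqxx mulr1.
Qed.

Lemma rV_cons_lift n (h a : R) (y : 'rV[R]_n) j :
  rV_cons (a, h *: delta_mx 0 j + y) = h *: delta_mx 0 (lift ord0 j) + rV_cons (a, y).
Proof.
apply/rowP => k; rewrite !mxE eqxx /=; case: (unliftP ord0 k) => [l ->|->].
  by rewrite !mxE eqxx /= (inj_eq lift_inj).
by rewrite (negbTE (neq_lift ord0 j)) mulr0 add0r.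
Qed.

Lemma rV_cons_continuousl n (y : 'rV[R]_n) : continuous (fun a : R => rV_cons (a, y)).
Proof.
move=> a A /= /nbhs_ballP[e e0 eA]; apply/nbhs_ballP; exists e => // b ab.
apply: eA; split=> // i k; rewrite !mxE /=; case: (unlift ord0 k) => [j|]//.
exact: ballxx.
Qed.

Lemma rV_cons_continuousr n (a : R) : continuous (fun y : 'rV[R]_n => rV_cons (a, y)).
Proof.
move=> y A /= /nbhs_ballP[e e0 eA]; apply/nbhs_ballP; exists e => // z [_ yz].
apply: eA; split=> // i k; rewrite !mxE /=; case: (unlift ord0 k) => [j|]//.
exact: ballxx.
Qed.

(** By induction on the dimension, following the recursive construction of the measure: Fubini
reduces to a lower dimension, or to the fundamental theorem of calculus for the first coordinate. *)
Lemma integral_pderiv_eq0 n (i : 'I_n) (F f : 'rV[R]_n -> R) M :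
  (forall x, is_derive x (delta_mx 0 i) F (f x)) -> continuous F -> continuous f ->
  (forall x, F x != 0 -> cube M x) -> (forall x, f x != 0 -> cube M x) ->
  (\int[lebesgue_rV R n]_x (f x)%:E = 0)%E.
Proof.
elim: n i F f => [[]//|n IH] i F f dF cF cf FM fM.
have mf := continuous_rV_measurable cf.
have mfc : measurable_fun setT (f \o @rV_cons R n).
  by apply: measurableT_comp => //; exact: measurable_rV_cons.
have ifc : (@lebesgue_measure R \x lebesgue_rV R n)%E.-integrable setT
    (EFin \o (f \o @rV_cons R n)).
  have [C fC] := cube_supp_bounded cf fM.
  apply: (@bounded_supp_integrable _ _ _ _ (@rV_cons R n @^-1` cube M) _ C) => //.
  - rewrite -[X in measurable X]setTI; apply: measurable_rV_cons => //.
    exact: measurable_cube.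
  - exact: (cube_fin n.+1 M).
  - by move=> x; exact: fC.
  - by move=> x; exact: fM.
rewrite /= [LHS](@integral_pushforward _ _ _ _ _ _ (@measurable_rV_cons R n))//;
  last exact/measurable_EFinP.
rewrite preimage_setT.
case: (unliftP ord0 i) => [j|] Ei; subst i.
  rewrite -(integral12_prod_meas1 ifc).
  rewrite [RHS](_ : _ = \int[@lebesgue_measure R]_x 0)%E; last by rewrite integral0.
  apply: eq_integral => a _; rewrite /fubini_F.
  apply: (IH j (fun y => F (rV_cons (a, y))) (fun y => f (rV_cons (a, y)))).
  - move=> y; suff : is_derive (0 *: delta_mx 0 j + y) (delta_mx 0 j)
        (fun z => F (rV_cons (a, z))) (f (rV_cons (a, y))) by rewrite scale0r add0r.
    apply/is_derive_lineP.
    rewrite (_ : (fun s => _) = (fun s : R => F (s *: delta_mx 0 (lift ord0 j) + rV_cons (a, y)))).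
      by apply/is_derive_lineP; rewrite scale0r add0r.
    by apply/funext => s; rewrite rV_cons_lift.
  - by move=> y; apply: continuous_comp; [exact: rV_cons_continuousr|exact: cF].
  - by move=> y; apply: continuous_comp; [exact: rV_cons_continuousr|exact: cf].
  - by move=> y /FM yM k; have := yM (lift ord0 k); rewrite mxE liftK.
  - by move=> y /fM yM k; have := yM (lift ord0 k); rewrite mxE liftK.
rewrite -(integral21_prod_meas1 ifc).
rewrite [RHS](_ : _ = \int[lebesgue_rV R n]_x 0)%E; last by rewrite integral0.
apply: eq_integral => y _; rewrite /fubini_G.
apply: (@integral_derive1_eq0 (fun a => F (rV_cons (a, y))) (fun a => f (rV_cons (a, y))) M).
- move=> a; rewrite (_ : (fun s => _) = (fun s : R => F (s *: delta_mx 0 ord0 + rV_cons (0, y)))).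
    by apply/is_derive_lineP; rewrite -rV_consE addr0.
  by apply/funext => s; rewrite -rV_consE addr0.
- by move=> a; apply: continuous_comp; [exact: rV_cons_continuousl|exact: cf].
- by move=> a /FM /(_ ord0); rewrite mxE unlift_none.
Qed.

End integral_derivative.

(** * Integrals that vanish on a generating family *)

Section measure_generic.
Context d (T : measurableType d) (R : realType) (mu : {measure set T -> \bar R}).

Lemma integral_lim_eq0 (D : set T) (f_ : nat -> T -> R) (f g : T -> R) :
  measurable D -> (forall k, measurable_fun D (f_ k)) -> measurable_fun D f ->
  (forall x, D x -> f_ k x @[k --> \oo] --> f x) ->
  mu.-integrable D (EFin \o g) -> (forall k x, D x -> `|f_ k x| <= g x) ->
  (forall k, (\int[mu]_(x in D) (f_ k x)%:E = 0)%E) ->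
  (\int[mu]_(x in D) (f x)%:E = 0)%E.
Proof.
move=> mD mf_ mf f_f ig f_g f_0.
have mE (h : T -> R) : measurable_fun D h -> measurable_fun D (EFin \o h) by move/measurable_EFinP.
have cE : {ae mu, forall x, D x -> (f_ k x)%:E @[k --> \oo] --> (f x)%:E}.
  apply: aeW => x Dx; apply: cvg_EFin; first exact: nearW.
  exact: f_f.
have bE : {ae mu, forall x k, D x -> (`|(f_ k x)%:E| <= (g x)%:E)%E}.
  by apply: aeW => x k Dx; rewrite lee_fin; exact: f_g.
have [_ _] := dominated_convergence mD (fun k => mE _ (mf_ k)) (mE f mf) cE ig bE.
rewrite (_ : (fun k => _) = cst 0%E); last by apply/funext => k; exact: f_0.
by move/cvg_lim => <-//; rewrite lim_cst.
Qed.

(** The sets over which f has integral zero form a Dynkin system. *)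
Lemma integral_pi_system_eq0 (D : set T) (f : T -> R) (G : set (set T)) :
  measurable D -> mu.-integrable D (EFin \o f) -> setI_closed G ->
  <<s G >> `<=` measurable ->
  (\int[mu]_(x in D) (f x)%:E = 0)%E ->
  (forall A, G A -> (\int[mu]_(x in D `&` A) (f x)%:E = 0)%E) ->
  forall A, <<s G >> A -> (\int[mu]_(x in D `&` A) (f x)%:E = 0)%E.
Proof.
move=> mD fi GI Gm fD fG A; rewrite -setI_closed_g_dynkin_g_sigma_algebra// => gA.
pose H := [set A | measurable A /\ (\int[mu]_(x in D `&` A) (f x)%:E = 0)%E].
suff /(_ A gA)[] : <<d G >> `<=` H by [].
apply: smallest_sub => [|B GB]; last first.
  by split; [apply: Gm; exact: sub_sigma_algebra|exact: fG].
have fiD B : measurable B -> mu.-integrable (D `&` B) (EFin \o f).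
  by move=> mB; apply: (integrableS mD) fi => //; exact: measurableI.
split.
- by split=> //; rewrite setIT.
- move=> B [mB fB]; split; first exact: measurableC.
  have := fD; rewrite -[in X in X -> _](setIT D) -(setvU B) setIUr.
  rewrite integral_setU_EFin//.
  + by rewrite fB adde0.
  + by apply: measurableI => //; exact: measurableC.
  + exact: measurableI.
  + rewrite -setIUr setvU setIT; exact/measurable_EFinP/(measurable_int _ fi).
  + by rewrite disj_set2E setIACA setICl setI0.
- move=> F tF HF; split; first by apply: bigcupT_measurable => k; have [] := HF k.
  rewrite setI_bigcupr integral_bigcup//.
  + by apply: eseries0 => k _ _; have [] := HF k.
  + by apply: trivIset_setIl.
  + by move=> k; apply: measurableI => //; have [] := HF k.
  + rewrite -setI_bigcupr; apply: fiD.
    by apply: bigcupT_measurable => k; have [] := HF k.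
Qed.

End measure_generic.

Lemma sigma_algebra_preimage_rays (R : realType) (T : Type) (S : set (set T)) (X : T -> R) :
  sigma_algebra setT S -> (forall a, S (X @^-1` `]a, +oo[%classic)) ->
  forall B : set R, measurable B -> S (X @^-1` B).
Proof.
move=> [S0 SC SU] Sray B.
have -> : @measurable _ R = <<s @RGenOInfty.G R >> := RGenOInfty.measurableE R.
suff : <<s @RGenOInfty.G R >> `<=` [set B | S (X @^-1` B)] by apply.
apply: smallest_sub => [|_ [a ->]]; last exact: Sray.
split=> /=.
- by rewrite preimage_set0.
- by move=> A SA; rewrite setTD preimage_setC -setTD; exact: SC.
- by move=> F SF; rewrite preimage_bigcup; exact: SU.
Qed.

Section orthants.
Context (R : realType) (n : nat).

(** The orthants form a pi-system generating the sigma-algebra. *)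
Definition orthant (a : 'rV[R]_n) : set 'rV[R]_n := [set x | forall j, a 0 j < x 0 j].

Lemma orthantI : setI_closed (range orthant).
Proof.
move=> _ _ [a _ <-] [b _ <-]; exists (\row_j Num.max (a 0 j) (b 0 j)) => //.
apply/seteqP; split=> [x xab|x [xa xb] j].
  by split=> j; have := xab j; rewrite mxE gt_max => /andP[].
by rewrite mxE gt_max xa xb.
Qed.

Lemma measurable_orthant a : measurable (orthant a).
Proof.
rewrite (_ : orthant a = [set x | forall j, `]a 0 j, +oo[%classic (x 0 j)]).
  exact: (@measurable_rV_box R n (fun j => `]a 0 j, +oo[%classic)).
by apply/seteqP; split=> x xa j; have := xa j; rewrite /= in_itv/= andbT.
Qed.

Lemma orthant_generates : measurable `<=` <<s range orthant >>.
Proof.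
have sO : sigma_algebra setT <<s range orthant >> by exact: smallest_sigma_algebra.
have [_ _ SU] := sO.
apply: smallest_sub => //.
rewrite -bigcup_seq; apply: bigcup_sub => i _ _ [B mB <-] /=.
rewrite setTI; apply: (sigma_algebra_preimage_rays sO) mB => a.
(* The half-space {x_i > a} is the union of the orthants with corner (-k, .., a, .., -k). *)
rewrite (_ : _ @^-1` _ = \bigcup_(k : nat) orthant (\row_j (if j == i then a else - k%:R))).
  by apply: SU => k; apply: sub_sigma_algebra; exists (\row_j (if j == i then a else - k%:R)).
apply/seteqP; split=> [x|x [k _] /(_ i)]; last first.
  by rewrite /= mxE eqxx in_itv/= andbT.
rewrite /= in_itv/= andbT => ax.
have [k Hk] : exists k : nat, \big[Num.max/0]_j `|x 0 j| < k%:R.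
  exists (Num.bound `|\big[Num.max/0]_j `|x 0 j| |).
  by rewrite (le_lt_trans (ler_norm _))// archi_boundP.
exists k => // j; rewrite mxE; case: eqP => [->//|_].
rewrite ltrNl (le_lt_trans (ler_norm _))// normrN (le_lt_trans _ Hk)//.
exact: (le_bigmax _ (fun j => `|x 0 j|) j).
Qed.

End orthants.

(** * Square-integrable functions *)

Lemma discriminant_le (R : realFieldType) (a b c : R) :
  0 <= c -> (forall t, 0 <= a + 2 * t * b + t ^+ 2 * c) -> b ^+ 2 <= a * c.
Proof.
rewrite le_eqVlt => /predU1P[c0|c0] H; last first.
  have := H (- (b / c)).
  rewrite (_ : a + _ + _ = a - b ^+ 2 / c); last by field; rewrite gt_eqF.
  by rewrite subr_ge0 ler_pdivrMr.
rewrite -c0 mulr0; have [->|b0] := eqVneq b 0; first by rewrite expr0n.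
have := H (- (a + 1) / (2 * b)).
rewrite -c0 (_ : a + _ + _ = - 1); last by field.
by rewrite oppr_ge0 ler10.
Qed.

Section L2theory.
Context (R : realType) (n : nat) (Omega : set 'rV[R]_n).
Hypotheses (mO : measurable Omega) (Ofin : (lebesgue_rV R n Omega < +oo)%E).
Implicit Types (u v w : 'rV[R]_n -> R).

Local Notation leb := (lebesgue_rV R n).
Local Notation L2 := (L2 Omega).
Local Notation integ u := (leb.-integrable Omega (EFin \o u)).

Definition L2dot u v : R := \int[leb]_(x in Omega) (u x * v x).

Lemma L2_mul u v : L2 u -> L2 v -> integ (u \* v).
Proof.
move=> [mu iu] [mv iv].
apply: (le_integrable mO _ _ (integrableD mO iu iv)).
  by apply/measurable_EFinP; exact: measurable_funM.
move=> x _ /=; rewrite lee_fin [leRHS]ger0_norm ?addr_ge0 ?sqr_ge0// ler_norml.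
by apply/andP; split; nra.
Qed.

Lemma L2_bounded u (C : R) : measurable_fun Omega u -> (forall x, Omega x -> `|u x| <= C) -> L2 u.
Proof.
move=> mu uC; split=> //.
apply: (measurable_bounded_integrable (f := fun x => u x ^+ 2)) => //.
  exact: measurable_funX.
exists (C ^+ 2); split; first by rewrite num_real.
move=> M CM x Ox /=; rewrite (le_trans _ (ltW CM))// normrX.
by rewrite ler_pXn2r ?nnegrE ?uC// (le_trans _ (uC x Ox)).
Qed.

Lemma L2_cst (c : R) : L2 (cst c).
Proof. by apply: (@L2_bounded _ `|c|). Qed.

Lemma L2_integrable u : L2 u -> integ u.
Proof.
move=> Lu; have := L2_mul Lu (L2_cst 1).
by rewrite (_ : u \* cst 1 = u)//; apply/funext => x; rewrite /= mulr1.
Qed.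

Lemma L2Z c u : L2 u -> L2 (fun x => c * u x).
Proof.
move=> [mu iu]; split; first exact: measurable_funM.
have := integrableZl mO (c ^+ 2) iu.
by apply: eq_integrable => // x _; rewrite exprMn EFinM.
Qed.

Lemma L2D u v : L2 u -> L2 v -> L2 (fun x => u x + v x).
Proof.
move=> Lu Lv; split; first by apply: measurable_funD; [exact: Lu.1|exact: Lv.1].
have := integrableD mO (integrableD mO Lu.2 Lv.2) (integrableZl mO 2 (L2_mul Lu Lv)).
by apply: eq_integrable => // x _ /=; rewrite -!EFinM -!EFinD; congr EFin; ring.
Qed.

Lemma L2B u v : L2 u -> L2 v -> L2 (fun x => u x - v x).
Proof.
move=> Lu Lv; have := L2D Lu (L2Z (-1) Lv).
by rewrite (_ : (fun x => _ + _) = (fun x => u x - v x))//; apply/funext => x; rewrite mulN1r.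
Qed.

Lemma L2_sum (J : Type) (r : seq J) (u : J -> 'rV[R]_n -> R) :
  (forall j, L2 (u j)) -> L2 (fun x => \sum_(j <- r) u j x).
Proof.
move=> Lu; elim: r => [|j r IH].
  by rewrite (_ : (fun x => _) = cst 0); [exact: L2_cst|apply/funext => x; rewrite big_nil].
rewrite (_ : (fun x => _) = (fun x => u j x + \sum_(k <- r) u k x)); first exact: L2D.
by apply/funext => x; rewrite big_cons.
Qed.

Lemma eq_dot u v u' v' : (forall x, Omega x -> u x = u' x) ->
  (forall x, Omega x -> v x = v' x) -> L2dot u v = L2dot u' v'.
Proof.
by move=> uu' vv'; apply: eq_Rintegral => x /set_mem Ox; rewrite uu' ?vv'.
Qed.

Lemma dotC u v : L2dot u v = L2dot v u.
Proof. by apply: eq_Rintegral => x _; rewrite mulrC. Qed.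

Lemma dotDr u v w : L2 u -> L2 v -> L2 w -> L2dot u (fun x => v x + w x) = L2dot u v + L2dot u w.
Proof.
move=> Lu Lv Lw; rewrite /L2dot -RintegralD//; try exact: L2_mul.
by apply: eq_Rintegral => x _; rewrite mulrDr.
Qed.

Lemma dotZr c u v : L2 u -> L2 v -> L2dot u (fun x => c * v x) = c * L2dot u v.
Proof.
move=> Lu Lv; rewrite /L2dot -RintegralZl//; try exact: L2_mul.
by apply: eq_Rintegral => x _; rewrite mulrCA.
Qed.

Lemma dotBr u v w : L2 u -> L2 v -> L2 w -> L2dot u (fun x => v x - w x) = L2dot u v - L2dot u w.
Proof.
move=> Lu Lv Lw; rewrite -[in RHS]mulN1r -dotZr// -dotDr//; last exact: L2Z.
by apply: eq_dot => // x _; rewrite mulN1r.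
Qed.

Lemma dot_sumr u (J : Type) (r : seq J) (v : J -> 'rV[R]_n -> R) : L2 u ->
  (forall j, L2 (v j)) -> L2dot u (fun x => \sum_(j <- r) v j x) = \sum_(j <- r) L2dot u (v j).
Proof.
move=> Lu Lv; elim: r => [|j r IH].
  rewrite big_nil -[RHS](mul0r (L2dot u (cst 1))) -dotZr//; last exact: L2_cst.
  by apply: eq_dot => // x _; rewrite big_nil /= mul0r.
rewrite big_cons -IH -dotDr//; last exact: L2_sum.
by apply: eq_dot => // x _; rewrite big_cons.
Qed.

Lemma dotDl u v w : L2 u -> L2 v -> L2 w -> L2dot (fun x => v x + w x) u = L2dot v u + L2dot w u.
Proof. by move=> Lu Lv Lw; rewrite dotC dotDr// !(dotC u). Qed.

Lemma dotZl c u v : L2 u -> L2 v -> L2dot (fun x => c * v x) u = c * L2dot v u.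
Proof. by move=> Lu Lv; rewrite dotC dotZr// (dotC u). Qed.

Lemma dotBl u v w : L2 u -> L2 v -> L2 w -> L2dot (fun x => v x - w x) u = L2dot v u - L2dot w u.
Proof. by move=> Lu Lv Lw; rewrite dotC dotBr// !(dotC u). Qed.

Lemma dot_suml u (J : Type) (r : seq J) (v : J -> 'rV[R]_n -> R) : L2 u ->
  (forall j, L2 (v j)) -> L2dot (fun x => \sum_(j <- r) v j x) u = \sum_(j <- r) L2dot (v j) u.
Proof. by move=> Lu Lv; rewrite dotC dot_sumr//; apply: eq_bigr => j _; rewrite dotC. Qed.

Lemma dot_ge0 u : 0 <= L2dot u u.
Proof. by apply: Rintegral_ge0 => x _; rewrite -expr2 sqr_ge0. Qed.

Lemma dot0l u : L2dot (cst 0) u = 0.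
Proof.
rewrite /L2dot (@eq_Rintegral _ _ _ _ _ (cst 0)); last by move=> x _; rewrite mul0r.
by rewrite Rintegral_cst// mul0r.
Qed.

(** The inequality is stated for finite families because the form ip of odd order is a sum over
coordinates. *)
Lemma dot_sum_CS (J : finType) (u v : J -> 'rV[R]_n -> R) :
  (forall j, L2 (u j)) -> (forall j, L2 (v j)) ->
  (\sum_j L2dot (u j) (v j)) ^+ 2 <= (\sum_j L2dot (u j) (u j)) * (\sum_j L2dot (v j) (v j)).
Proof.
move=> Lu Lv; apply: discriminant_le => [|t]; first by apply: sumr_ge0 => j _; exact: dot_ge0.
have Ltv j : L2 (fun x => t * v j x) by exact: L2Z.
have LD j : L2 (fun x => u j x + t * v j x) by exact: L2D.
rewrite !mulr_sumr -!big_split/=; apply: sumr_ge0 => j _.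
have := dot_ge0 (fun x => u j x + t * v j x).
rewrite dotDr ?dotDl ?dotZr ?dotZl// (dotC (v j) (u j)).
by move/le_trans; apply; rewrite le_eqVlt; apply/orP; left; apply/eqP; ring.
Qed.

Lemma dot_CS u v : L2 u -> L2 v -> L2dot u v ^+ 2 <= L2dot u u * L2dot v v.
Proof.
move=> Lu Lv; have := @dot_sum_CS unit (fun=> u) (fun=> v) (fun=> Lu) (fun=> Lv).
by rewrite !big_const !card_unit/= !addr0.
Qed.

(** Pointwise this is v^2 <= (1 + e) u^2 + (1 + 1/e) (u - v)^2, the substitute for the triangle
inequality that avoids square roots. *)
Lemma dot_perturb u v (e : R) : L2 u -> L2 v -> 0 < e ->
  L2dot v v <= (1 + e) * L2dot u u + (1 + e^-1) * L2dot (fun x => u x - v x) (fun x => u x - v x).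
Proof.
move=> Lu Lv e0; have Luv := L2B Lu Lv.
have Leu : L2 (fun x => e * u x) by exact: L2Z.
have Lw : L2 (fun x => e * u x + (u x - v x)) by exact: L2D.
(* The two sides differ by 1/e times the square of e u + (u - v). *)
have := dot_ge0 (fun x => e * u x + (u x - v x)).
rewrite (dotDr Lw Leu Luv) (dotDl Leu Leu Luv) (dotDl Luv Leu Luv).
rewrite !(dotZr e _ Lu)// !(dotZl e _ Lu)// (dotBr Lu Lu Lv) (dotBr Luv Lu Lv).
rewrite !(dotBl _ Lu Lv)// (dotC v u) => H.
rewrite -subr_ge0 -(pmulr_rge0 _ e0); move: H.
move/le_trans; apply; rewrite le_eqVlt; apply/orP; left; apply/eqP.
by field; rewrite gt_eqF.
Qed.

Lemma L2_ae_eq_dot u u' v : L2 u -> L2 u' -> L2 v -> ae_eq leb Omega u u' -> L2dot u v = L2dot u' v.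
Proof.
move=> Lu Lu' Lv uu'; rewrite /L2dot /Rintegral; congr fine; apply: ae_eq_integral => //.
- exact: (measurable_int _ (L2_mul Lu Lv)).
- exact: (measurable_int _ (L2_mul Lu' Lv)).
- by apply: filterS uu' => x H Ox; rewrite H.
Qed.

Lemma dot_eq0_ae u : L2 u -> L2dot u u = 0 -> ae_eq leb Omega u (cst 0).
Proof.
move=> Lu uu0.
have uu x : (`|(u x * u x)%:E| = (u x * u x)%:E)%E by rewrite gee0_abs// lee_fin -expr2 sqr_ge0.
have := (ae_eq_integral_abs leb mO (measurable_int _ (L2_mul Lu Lu))).1.
rewrite (eq_integral (fun x => (u x * u x)%:E)) => [H|x _]; last exact: uu.
have /H : (\int[leb]_(x in Omega) (u x * u x)%:E = 0)%E.
  move: uu0; rewrite /L2dot/Rintegral => uu0.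
  rewrite -(fineK (integrable_fin_num mO (L2_mul Lu Lu))) /=.
  by rewrite [fine _]uu0.
apply: filterS => x Hx Ox; have := Hx Ox => /= -[/eqP].
by rewrite mulf_eq0 orbb => /eqP.
Qed.

End L2theory.

(** * The fundamental lemma of the calculus of variations *)

Section bump_limit.
Context (R : realType).
Implicit Types (t : R) (k : nat).

Lemma flat_exp0_le1 t : flat_exp 0 t <= 1.
Proof.
rewrite /flat_exp; case: ifPn => // t0.
by rewrite expr0 mul1r expR_le1 oppr_le0 invr_ge0 ltW.
Qed.

Lemma flat_exp_gt0 k t : flat_exp k t != 0 -> 0 < t.
Proof. by rewrite /flat_exp; case: ifPn => //; rewrite eqxx. Qed.

Lemma cvg_harmonic_scale (c : R) : c / k.+1%:R @[k --> \oo] --> 0.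
Proof.
rewrite -(mulr0 c); apply: cvgM; first exact: cvg_cst.
exact: cvg_harmonic.
Qed.

Lemma flat_exp0_cvg t : flat_exp 0 (k.+1%:R * t) @[k --> \oo] --> ((0 < t)%R%:R : R).
Proof.
rewrite /flat_exp; have [t0|t0] := ltP 0 t; last first.
  rewrite (_ : (fun k => _) = cst 0); first exact: cvg_cst.
  by apply/funext => k; rewrite ltNge mulr_ge0_le0.
rewrite (_ : (fun k => _) = expR \o (fun k => - (t^-1 / k.+1%:R))).
  rewrite [X in _ --> X](_ : _ = expR (- 0)); last by rewrite oppr0 expR0.
  apply: continuous_cvg; first exact: continuous_expR.
  by apply: cvgN; exact: cvg_harmonic_scale.
by apply/funext => k /=; rewrite mulr_gt0// expr0 mul1r invfM mulrC.
Qed.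

Lemma cvg_prod_seq (J : Type) (r : seq J) (a : nat -> J -> R) (l : J -> R) :
  (forall j, a k j @[k --> \oo] --> l j) ->
  \prod_(j <- r) a k j @[k --> \oo] --> \prod_(j <- r) l j.
Proof.
move=> al; elim: r => [|j r IH].
  rewrite big_nil (_ : (fun k => _) = cst 1); first exact: cvg_cst.
  by apply/funext => k; rewrite big_nil.
rewrite big_cons (_ : (fun k => _) = (fun k => a k j * \prod_(j <- r) a k j)).
  by apply: cvgM.
by apply/funext => k; rewrite big_cons.
Qed.

End bump_limit.

Section box_bump.
Context (R : realType) (n : nat) (lo hi : 'I_n -> R).

(** Positive exactly on the open box between lo and hi; increases to its indicator as k grows. *)
Definition box_bump (k : nat) (x : 'rV[R]_n) : R :=
  \prod_(j < n) (flat_exp 0 (k.+1%:R * (x 0 j - lo j)) *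
                 flat_exp 0 (k.+1%:R * (hi j - x 0 j))).

Lemma box_bump_smooth k : smooth (box_bump k).
Proof.
apply: smooth_prod => j.
have := smoothM
  (@smooth_affine_comp R n (flat_exp 0) j k.+1%:R (- (k.+1%:R * lo j))
    (fun N => flat_exp_Ck R N 0))
  (@smooth_affine_comp R n (flat_exp 0) j (- k.+1%:R) (k.+1%:R * hi j)
    (fun N => flat_exp_Ck R N 0)).
set f := (X in smooth X); set g := (X in _ -> smooth X).
suff -> : f = g by [].
by apply/funext => x; rewrite /f /g /= -mulrN -mulrDr mulNr -mulrN -mulrDr [hi j - _]addrC.
Qed.

Lemma box_bump_ge0 k x : 0 <= box_bump k x.
Proof. by apply: prodr_ge0 => j _; rewrite mulr_ge0// flat_exp_ge0. Qed.

Lemma box_bump_le1 k x : box_bump k x <= 1.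
Proof.
apply: (@le_trans _ _ (\prod_(j < n) (1 : R))); last by rewrite big1_eq.
apply: ler_prod => j _; rewrite mulr_ge0 ?flat_exp_ge0//=.
by rewrite mulr_ile1 ?flat_exp_ge0 ?flat_exp0_le1.
Qed.

Lemma box_bump_supp k x : box_bump k x != 0 -> forall j, lo j < x 0 j < hi j.
Proof.
rewrite /box_bump prodf_seq_neq0 => /allP H j.
have /= := H j (mem_index_enum _); rewrite mulf_eq0 negb_or => /andP[/flat_exp_gt0 + /flat_exp_gt0].
by rewrite !pmulr_rgt0// !subr_gt0 => -> ->.
Qed.

Lemma box_bump_cvg x :
  box_bump k x @[k --> \oo] -->
  (\1_[set y : 'rV[R]_n | forall j, lo j < y 0 j < hi j] x : R).
Proof.
have -> : \1_[set y : 'rV[R]_n | forall j, lo j < y 0 j < hi j] x =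
    \prod_(j < n) ((0 < x 0 j - lo j)%R%:R * (0 < hi j - x 0 j)%R%:R) :> R.
  rewrite indicE; have [H|H] := pselect (forall j, lo j < x 0 j < hi j).
    by rewrite mem_set// big1// => j _; rewrite !subr_gt0; have /andP[-> ->] := H j; rewrite mulr1.
  rewrite memNset//; apply/esym/eqP; rewrite prodf_seq_eq0; apply/hasP.
  apply: contrapT => nH; apply: H => j.
  apply: contrapT => nj; apply: nH; exists j => /=; first exact: mem_index_enum.
  rewrite !subr_gt0 mulf_eq0 !pnatr_eq0 !eqb0 -negb_and.
  exact/negP.
by apply: cvg_prod_seq => j; apply: cvgM; exact: flat_exp0_cvg.
Qed.

End box_bump.

Section domain.
Context (R : realType) (n : nat) (Omega : set 'rV[R]_n) (M : R).
Hypotheses (oO : open Omega) (OM : Omega `<=` cube M).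
Implicit Types (u v w phi psi : 'rV[R]_n -> R) (i j : 'I_n) (s t : seq 'I_n).

Local Notation leb := (lebesgue_rV R n).
Local Notation L2 := (L2 Omega).
Local Notation test := (test_fun Omega).
Local Notation dot := (L2dot Omega).

Lemma domain_measurable : measurable Omega.
Proof. exact: open_rV_measurable. Qed.
Let mO := domain_measurable.

Lemma domain_fin : (leb Omega < +oo)%E.
Proof.
apply: le_lt_trans (cube_fin n M); apply: le_measure; rewrite ?inE//.
exact: measurable_cube.
Qed.
Let Ofin := domain_fin.

Lemma L2_continuous u : continuous u -> L2 u.
Proof.
move=> cu.
have /compact_bounded[C [_ HC]] : compact (u @` cube M).
  by apply: continuous_compact; [exact: continuous_subspaceT|exact: compact_cube].
apply: (@L2_bounded _ _ _ mO Ofin _ (C + 1)).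
  by apply: measurable_funTS; exact: continuous_rV_measurable.
move=> x /OM Ox; apply: HC; last by exists x.
by rewrite ltrDl.
Qed.

Lemma L2_smooth u : smooth u -> L2 u.
Proof. by move=> /smooth_continuous; exact: L2_continuous. Qed.

Lemma L2_test phi : test phi -> L2 phi.
Proof. by move=> /test_smooth; exact: L2_smooth. Qed.

Lemma integral_test_pderiv i phi : test phi -> \int[leb]_(x in Omega) pderiv i phi x = 0.
Proof.
move=> tp; have tdp := test_pderiv i tp.
have [K HK] := test_bounded tp; have [K' HK'] := test_bounded tdp.
have cubeS (x : 'rV[R]_n) (a b : R) : a <= b -> cube a x -> cube b x.
  by move=> ab xa k; exact: (le_trans (xa k)).
rewrite /Rintegral integral_mkcond.
rewrite (_ : _ \_ _ = (fun x => (pderiv i phi x)%:E)); last first.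
  apply/funext => x; rewrite /patch; case: ifPn => //.
  by rewrite notin_setE => nOx; rewrite (test_out tdp).
suff -> : (\int[leb]_x (pderiv i phi x)%:E = 0)%E by [].
apply: (@integral_pderiv_eq0 R n i phi (pderiv i phi) (Num.max K K')).
- by move=> x; exact: (smooth_is_derive i x (test_smooth tp)).
- exact: (smooth_continuous (test_smooth tp)).
- exact: (smooth_continuous (test_smooth tdp)).
- by move=> x px; apply: (cubeS _ K); [rewrite le_max lexx|exact: HK].
- by move=> x px; apply: (cubeS _ K'); [rewrite le_max lexx orbT|exact: HK'].
Qed.

Lemma by_parts i u phi : smooth u -> test phi ->
  dot u (pderiv i phi) = - dot (pderiv i u) phi.
Proof.
move=> su tp; have sp := test_smooth tp.
have Lu := L2_smooth su; have Lp := L2_test tp.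
have Ldu := L2_smooth (smooth_pderiv i su); have Ldp := L2_smooth (smooth_pderiv i sp).
apply/eqP; rewrite -addr_eq0 /dot -RintegralD//; [|exact: (L2_mul mO)..].
rewrite -(integral_test_pderiv i (test_mul su tp)) (pderivM i su sp).
by apply/eqP; apply: eq_Rintegral => x _; rewrite [phi x * _]mulrC.
Qed.

Lemma pderivs_pderiv s i u : smooth u -> pderivs s (pderiv i u) = pderiv i (pderivs s u).
Proof.
move=> su; elim: s => [//|j s IH].
rewrite [LHS]/= -/(pderivs s (pderiv i u)) IH.
exact: (pderivC j i (smooth_pderivs s su)).
Qed.

(** Integration by parts moves the derivatives one by one and reverses their order;
pderivs_pderiv restores it. *)
Lemma smooth_wderiv s u : smooth u -> is_wderiv Omega s u (pderivs s u).
Proof.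
elim: s u => [|i s IH] u su phi tp; first by rewrite /= expr0 mul1r.
have tsp := test_pderivs s tp.
rewrite -[LHS]/(dot u (pderiv i (pderivs s phi))) (by_parts i su tsp).
rewrite [dot (pderiv i u) _](IH _ (smooth_pderiv i su) _ tp) (pderivs_pderiv s i su).
by rewrite /= exprS !mulN1r mulNr.
Qed.

(** Bumps converge to indicators of boxes, so u has integral zero over every box contained in a cube
inside Omega; such boxes generate, hence u vanishes almost everywhere on each cube, and countably
many cubes cover Omega. *)
Lemma dot_test_eq0_ae u : L2 u -> (forall phi, test phi -> dot u phi = 0) ->
  ae_eq leb Omega u (cst 0).
Proof.
move=> Lu u0.
have iu := L2_integrable mO Ofin Lu.
have box0 p (lo hi : 'I_n -> R) : rat_closed_cube p `<=` Omega ->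
    [set x : 'rV[R]_n | forall j, lo j < x 0 j < hi j] `<=` rat_open_cube p ->
    (\int[leb]_(x in Omega `&` [set x : 'rV[R]_n | forall j, (lo j < x 0 j < hi j)%R])
      (u x)%:E = 0)%E.
  set B := [set x | _] => pO Bp.
  have mB : measurable B.
    rewrite (_ : B = [set x | forall j, `]lo j, hi j[%classic (x 0 j)]).
      exact: (@measurable_rV_box R n (fun j => `]lo j, hi j[%classic)).
    by apply/seteqP; split=> x xa j; have := xa j; rewrite /= in_itv.
  have tb k : test (box_bump lo hi k).
    have clp : closed (rat_closed_cube p : set 'rV[R]_n).
      rewrite (_ : (rat_closed_cube p : set 'rV[R]_n) = \bigcap_j
          ((fun x : 'rV[R]_n => `|x 0 j - rat_center R p j|) @^-1`
            [set y | y <= p.2.+1%:R^-1])).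
        apply: closed_bigI => j _; apply: closed_comp; last exact: closed_le.
        move=> x _; apply: (@continuous_comp _ _ _
          (fun x : 'rV[R]_n => x 0 j - rat_center R p j) (fun y : R => `|y|)).
          exact: (cvgB (@coord_continuous R 1 n 0 j x) (cvg_cst _)).
        exact: norm_continuous.
      by apply/seteqP; split=> x xp j => [_|]; exact: xp.
    have cpp : compact (rat_closed_cube p : set 'rV[R]_n).
      apply: (subclosed_compact clp (@compact_cube R n M)).
      exact: subset_trans OM.
    have sub : closure [set x | box_bump lo hi k x != 0] `<=` rat_closed_cube p.
      rewrite [X in _ `<=` X](closure_id _).1//; apply: closureS => x /box_bump_supp xB.
      exact/rat_cube_subset/Bp.
    split; first exact: box_bump_smooth.
      by apply: subclosed_compact cpp sub; exact: closed_closure.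
    exact: subset_trans pO.
  rewrite integral_mkcondr.
  rewrite (_ : _ \_ _ = fun x => (u x * \1_B x)%:E); last first.
    apply/funext => x; rewrite /patch indicE; case: ifPn => _; first by rewrite mulr1.
    by rewrite mulr0.
  apply: (@integral_lim_eq0 _ _ _ leb Omega (fun k x => u x * box_bump lo hi k x) _
    (fun x => `|u x|)) => //.
  - move=> k; apply: measurable_funM; first exact: Lu.1.
    exact: (L2_test (tb k)).1.
  - by apply: measurable_funM; [exact: Lu.1|exact: measurable_indic].
  - by move=> x _; apply: cvgM; [exact: cvg_cst|exact: box_bump_cvg].
  - exact: integrable_norm.
  - move=> k x _; rewrite normrM ler_piMr// ger0_norm ?box_bump_ge0//.
    exact: box_bump_le1.
  - move=> k; have := u0 _ (tb k); rewrite /dot/Rintegral => H.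
    have Lb := L2_test (tb k).
    by rewrite -(fineK (integrable_fin_num mO (L2_mul mO Lu Lb))) /= [fine _]H.
have cube0 p : rat_closed_cube p `<=` Omega -> ae_eq leb (rat_open_cube p) u (cst 0).
  move=> pO.
  have mp := @measurable_rat_open_cube R n p.
  have pO' : rat_open_cube p `<=` Omega by apply: subset_trans pO; exact: rat_cube_subset.
  have iup : leb.-integrable (rat_open_cube p) (EFin \o u) by exact: integrableS iu.
  have H A : measurable A -> (\int[leb]_(x in rat_open_cube p `&` A) (u x)%:E = 0)%E.
    have cubeE : rat_open_cube p = [set x : 'rV[R]_n | forall j,
        rat_center R p j - p.2.+1%:R^-1 < x 0 j < rat_center R p j + p.2.+1%:R^-1].
      by apply/seteqP; split=> x xp j; have := xp j; rewrite ltr_distl.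
    move=> /orthant_generates; apply: integral_pi_system_eq0 => //.
    - exact: orthantI.
    - apply: smallest_sub; first exact: sigma_algebra_measurable.
      by move=> _ [a _ <-]; exact: measurable_orthant.
    - have := box0 p (fun j => rat_center R p j - p.2.+1%:R^-1)
        (fun j => rat_center R p j + p.2.+1%:R^-1) pO.
      by rewrite -cubeE (setIidr pO'); apply.
    - move=> _ [a _ <-].
      have E : rat_open_cube p `&` orthant a = [set x : 'rV[R]_n | forall j,
          Num.max (rat_center R p j - p.2.+1%:R^-1) (a 0 j) < x 0 j <
          rat_center R p j + p.2.+1%:R^-1].
        rewrite cubeE; apply/seteqP; split=> [x [xp xa] j|x xp].
          by rewrite gt_max xa; have /andP[-> ->] := xp j.
        by split=> j; have := xp j; rewrite gt_max -andbA => /and3P[h1 h2 h3]; rewrite ?h1 ?h2 ?h3.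
      have := box0 p (fun j => Num.max (rat_center R p j - p.2.+1%:R^-1) (a 0 j))
        (fun j => rat_center R p j + p.2.+1%:R^-1) pO.
      rewrite -E setIA (setIidr pO'); apply; exact: subIsetl.
  have : ae_eq leb (rat_open_cube p) (EFin \o u) (cst 0%E).
    apply: integral_ae_eq => // E Ep mE.
    by rewrite -(setIidr Ep) H// integral0.
  by apply: filterS => x + px => /(_ px) /= -[].
have : \forall x \ae leb, forall k : nat, if unpickle k is Some p then
    rat_closed_cube p `<=` Omega -> rat_open_cube p x -> u x = 0 else True.
  apply: ae_foralln => k; case: unpickle => [p|]; last exact: aeW.
  have [pO|pO] := pselect (rat_closed_cube p `<=` Omega); last exact: aeW.
  by apply: filterS (cube0 p pO) => x H _ px; rewrite H.
apply: filterS => x H Ox; have [p px pO] := rat_cube_cover oO Ox.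
by have := H (pickle p); rewrite pickleK; exact.
Qed.

Lemma wderiv_unique s u v v' : L2 v -> L2 v' ->
  is_wderiv Omega s u v -> is_wderiv Omega s u v' -> ae_eq leb Omega v v'.
Proof.
move=> Lv Lv' uv uv'.
have : ae_eq leb Omega (fun x => v x - v' x) (cst 0).
  apply: dot_test_eq0_ae; first exact: L2B.
  move=> phi tp; have Lp := L2_test tp; rewrite dotBl//.
  have := uv' phi tp; rewrite (uv phi tp).
  have sn : (-1 : R) ^+ size s != 0 by rewrite signr_eq0.
  move/(mulfI sn) => E; rewrite -[dot v phi]/(\int[leb]_(x in Omega) (v x * phi x)) E.
  exact: subrr.
by apply: filterS => x H Ox; apply/eqP; rewrite -subr_eq0; apply/eqP; exact: H.
Qed.

End domain.

(** * The Laplacian of smooth functions *)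

Section laplacian.
Context (R : realType) (n : nat).
Implicit Types (u phi : 'rV[R]_n -> R) (i : 'I_n) (s : seq 'I_n).

Definition lap u : 'rV[R]_n -> R := fun x => \sum_i pderivs [:: i; i] u x.

Lemma smooth_lap u : smooth u -> smooth (lap u).
Proof. by move=> su; apply: smooth_sum => i; exact: (smooth_pderivs [:: i; i] su). Qed.

Lemma smooth_iter_lap k u : smooth u -> smooth (iter k lap u).
Proof. by move=> su; elim: k => [//|k IH]; exact: smooth_lap. Qed.

Lemma pderivs_sum s (u : 'I_n -> 'rV[R]_n -> R) : (forall j, smooth (u j)) ->
  pderivs s (fun x => \sum_j u j x) = (fun x => \sum_j pderivs s (u j) x).
Proof.
move=> su; elim: s => [//|i s IH].
transitivity (pderiv i (fun x => \sum_j pderivs s (u j) x)); first by rewrite -IH.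
exact: (pderiv_sum i _ (fun j => smooth_pderivs s (su j))).
Qed.

Lemma pderivs_lap s u : smooth u ->
  pderivs s (lap u) = (fun x => \sum_i pderivs (i :: i :: s) u x).
Proof.
move=> su; rewrite pderivs_sum => [|i]; last exact: (smooth_pderivs [:: i; i] su).
apply/funext => x; apply: eq_bigr => i _.
rewrite [pderivs [:: i; i] u]/= (pderivs_pderiv s i (smooth_pderiv i su)).
by rewrite (pderivs_pderiv s i su).
Qed.

Lemma pderiv_iter_lap k i u : smooth u -> pderiv i (iter k lap u) = iter k lap (pderiv i u).
Proof.
move=> su; elim: k => [//|k IH].
rewrite !iterS -IH -[LHS]/(pderivs [:: i] (lap (iter k lap u))).
have sk := smooth_iter_lap k su.
by rewrite (pderivs_lap [:: i] sk).
Qed.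

Variable Omega : set 'rV[R]_n.

(** The value of ip m u u for smooth u, with classical derivatives in place of chosen weak ones. *)
Definition smooth_ip m u : R :=
  let du := iter m./2 lap u in
  if odd m then \sum_i L2dot Omega (pderiv i du) (pderiv i du) else L2dot Omega du du.

Lemma test_lap phi : test_fun Omega phi -> test_fun Omega (lap phi).
Proof.
move=> tp; apply: (test_sub tp); first exact: (smooth_lap (test_smooth tp)).
move=> x lx; apply: contrapT => nx; case/eqP: lx.
rewrite /lap big1// => i _; apply/eqP; apply: contra_notT nx => dx.
have := closureS (fun y => @pderiv_support _ _ i phi y) (pderiv_support dx).
by rewrite -(closure_id _).1//; exact: closed_closure.
Qed.

Lemma test_iter_lap k phi : test_fun Omega phi -> test_fun Omega (iter k lap phi).
Proof. by move=> tp; elim: k => [//|k IH]; exact: test_lap. Qed.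

End laplacian.

(** * Weak derivatives *)

Section weak.
Context (R : realType) (n : nat) (Omega : set 'rV[R]_n) (M : R).
Hypotheses (oO : open Omega) (OM : Omega `<=` cube M).
Implicit Types (u v w phi psi : 'rV[R]_n -> R) (i j : 'I_n) (s t : seq 'I_n).

Local Notation leb := (lebesgue_rV R n).
Local Notation L2 := (L2 Omega).
Local Notation test := (test_fun Omega).
Local Notation dot := (L2dot Omega).
Local Notation wderiv := (wderiv Omega).
Local Notation is_wderiv := (is_wderiv Omega).
Local Notation sobolev := (sobolev Omega).
Local Notation wlap := (wlap Omega).

Let mO : measurable Omega := domain_measurable oO.
Let Ofin : (leb Omega < +oo)%E := domain_fin oO OM.

Lemma is_wderivE s u v : is_wderiv s u v <->
  forall phi, test phi -> dot u (pderivs s phi) = (-1) ^+ size s * dot v phi.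
Proof. by []. Qed.

Lemma wderivP s u : (exists v, L2 v /\ is_wderiv s u v) ->
  L2 (wderiv s u) /\ is_wderiv s u (wderiv s u).
Proof. by move=> ex; have := @xgetPex _ (cst 0) [set v | L2 v /\ is_wderiv s u v] ex. Qed.

Lemma L2_wderiv s u : L2 (wderiv s u).
Proof.
have [ex|nex] := pselect (exists v, L2 v /\ is_wderiv s u v).
  by have [] := wderivP ex.
rewrite /wderiv xgetPN; first exact: L2_cst.
by move=> v h; apply: nex; exists v.
Qed.

Lemma wderiv_ae s u v : L2 v -> is_wderiv s u v -> ae_eq leb Omega (wderiv s u) v.
Proof.
move=> Lv uv; have [Lw uw] := wderivP (ex_intro _ v (conj Lv uv)).
exact: (wderiv_unique oO OM Lw Lv uw uv).
Qed.

Lemma wderiv_smooth s u : smooth u -> ae_eq leb Omega (wderiv s u) (pderivs s u).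
Proof.
move=> su; apply: wderiv_ae; last exact: (smooth_wderiv oO OM).
exact: (L2_smooth oO OM (smooth_pderivs s su)).
Qed.

Lemma is_wderiv_cat s t u v : (exists v, L2 v /\ is_wderiv s u v) ->
  is_wderiv t (wderiv s u) v <-> is_wderiv (s ++ t) u v.
Proof.
move=> /wderivP[_ uw]; split=> H; apply/is_wderivE => phi tp;
    have := (is_wderivE _ _ _).1 H phi tp; have := (is_wderivE _ _ _).1 uw _ (test_pderivs t tp);
    rewrite -[pderivs s (pderivs t phi)](foldr_cat (@pderiv R n)) => E1 E2.
  by rewrite [LHS]E1 E2 mulrA -exprD size_cat.
apply: (@mulfI _ ((-1) ^+ size s)); first by rewrite signr_eq0.
by rewrite -E1 [LHS]E2 mulrA -exprD size_cat.
Qed.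

(** Both sides choose a representative from the same set, so the equality is not merely almost
everywhere. *)
Lemma wderiv_cat s t u : (exists v, L2 v /\ is_wderiv s u v) ->
  wderiv t (wderiv s u) = wderiv (s ++ t) u.
Proof.
move=> ex; rewrite {1}/Defs.wderiv [in RHS]/Defs.wderiv; congr (xget _ _).
by apply/seteqP; split=> v [Lv] /(is_wderiv_cat t v ex).
Qed.

Lemma is_wderiv_ae_eq s u u' v : L2 u -> L2 u' -> ae_eq leb Omega u u' ->
  is_wderiv s u v -> is_wderiv s u' v.
Proof.
move=> Lu Lu' uu' uv; apply/is_wderivE => phi tp.
rewrite -(L2_ae_eq_dot mO Lu Lu' _ uu'); first exact: ((is_wderivE _ _ _).1 uv).
exact: (L2_test oO OM (test_pderivs s tp)).
Qed.

(** Functions equal almost everywhere have the same set of weak derivatives, hence the same chosen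
one. *)
Lemma wderiv_ae_eq s u u' : L2 u -> L2 u' -> ae_eq leb Omega u u' ->
  wderiv s u = wderiv s u'.
Proof.
move=> Lu Lu' uu'; rewrite /Defs.wderiv; congr (xget _ _).
by apply/seteqP; split=> v [Lv vw]; split=> //; apply: is_wderiv_ae_eq vw => //; exact: ae_eq_sym.
Qed.

Lemma is_wderivB s u u' v v' : L2 u -> L2 u' -> L2 v -> L2 v' ->
  is_wderiv s u v -> is_wderiv s u' v' ->
  is_wderiv s (fun x => u x - u' x) (fun x => v x - v' x).
Proof.
move=> Lu Lu' Lv Lv' /is_wderivE uv /is_wderivE uv'; apply/is_wderivE => phi tp.
have Lp := L2_test oO OM tp; have Ldp := L2_test oO OM (test_pderivs s tp).
by rewrite !(dotBl mO)// uv// uv'// mulrBr.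
Qed.

Lemma is_wderivZ s c u v : L2 u -> L2 v ->
  is_wderiv s u v -> is_wderiv s (fun x => c * u x) (fun x => c * v x).
Proof.
move=> Lu Lv /is_wderivE uv; apply/is_wderivE => phi tp.
have Lp := L2_test oO OM tp; have Ldp := L2_test oO OM (test_pderivs s tp).
by rewrite !(dotZl mO)// uv// mulrCA.
Qed.

Lemma sobolevP m u s : sobolev m u -> (size s <= m)%N -> is_wderiv s u (wderiv s u).
Proof. by move=> [_ H] /H /wderivP[]. Qed.

Lemma sobolev_smooth m u : smooth u -> sobolev m u.
Proof.
move=> su; split=> [|s _]; first exact: (L2_smooth oO OM).
exists (pderivs s u); split; last exact: (smooth_wderiv oO OM).
exact: (L2_smooth oO OM (smooth_pderivs s su)).
Qed.

Lemma sobolevZ m c u : sobolev m u -> sobolev m (fun x => c * u x).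
Proof.
move=> [Lu H]; split=> [|s /H[v [Lv uv]]]; first exact: L2Z.
by exists (fun x => c * v x); split; [exact: L2Z|exact: is_wderivZ].
Qed.

Lemma wderivZ_ae m s c u : sobolev m u -> (size s <= m)%N ->
  ae_eq leb Omega (wderiv s (fun x => c * u x)) (fun x => c * wderiv s u x).
Proof.
move=> su sm; apply: wderiv_ae; first exact/L2Z/L2_wderiv.
apply: is_wderivZ; [exact: su.1|exact: L2_wderiv|exact: sobolevP su sm].
Qed.

Lemma sobolev_wderiv m s u : sobolev (size s + m) u -> sobolev m (wderiv s u).
Proof.
move=> [Lu H]; split=> [|t tm]; first exact: L2_wderiv.
have [v [Lv uv]] : exists v, L2 v /\ is_wderiv (s ++ t) u v.
  by apply: H; rewrite size_cat leq_add2l.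
exists v; split=> //; apply/is_wderiv_cat => //.
by apply: H; rewrite leq_addr.
Qed.

Lemma is_wderiv_wlap m s u : sobolev m.+2 u -> (size s <= m)%N ->
  is_wderiv s (wlap u) (fun x => \sum_i wderiv (i :: i :: s) u x).
Proof.
move=> su sm; apply/is_wderivE => phi tp.
have Lp := L2_test oO OM tp; have Ldp := L2_test oO OM (test_pderivs s tp).
rewrite !(dot_suml mO Ofin)//; try by move=> i; exact: L2_wderiv.
rewrite mulr_sumr; apply: eq_bigr => i _.
have ex : exists v, L2 v /\ is_wderiv [:: i; i] u v by apply: su.2.
apply: ((is_wderivE _ _ _).1 _ _ tp); apply/(is_wderiv_cat _ _ ex).
exact: sobolevP su _.
Qed.

Lemma L2_wlap u : L2 (wlap u).
Proof. by apply: L2_sum => // i; exact: L2_wderiv. Qed.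

Lemma sobolev_wlap m u : sobolev m.+2 u -> sobolev m (wlap u).
Proof.
move=> su; split=> [|s sm]; first exact: L2_wlap.
exists (fun x => \sum_i wderiv (i :: i :: s) u x); split; last exact: is_wderiv_wlap su sm.
by apply: L2_sum => // i; exact: L2_wderiv.
Qed.

Lemma sobolev_iter_wlap k m u : sobolev (k.*2 + m) u -> sobolev m (iter k wlap u).
Proof.
elim: k u => [//|k IH] u su; rewrite iterSr; apply: IH.
by apply: sobolev_wlap.
Qed.

Lemma L2_iter_wlap k u : L2 u -> L2 (iter k wlap u).
Proof. by case: k => // k _; exact: L2_wlap. Qed.

Lemma iter_wlap_smooth k u : smooth u -> ae_eq leb Omega (iter k wlap u) (iter k (@lap R n) u).
Proof.
move=> su; elim: k => [|k IH]; first exact: ae_eq_refl.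
have sk := smooth_iter_lap k su.
have Lk : L2 (iter k wlap u) by apply: L2_iter_wlap; exact: (L2_smooth oO OM).
rewrite !iterS /Defs.wlap /lap.
under [X in ae_eq _ _ X _]funext => x do under eq_bigr => i _ do
  rewrite (wderiv_ae_eq [:: i; i] Lk (L2_smooth oO OM sk) IH).
have : \forall x \ae leb, forall i, Omega x ->
    wderiv [:: i; i] (iter k (@lap R n) u) x = pderivs [:: i; i] (iter k (@lap R n) u) x.
  apply: filter_forall => i; exact: wderiv_smooth.
by apply: filterS => x H Ox; apply: eq_bigr => i _; exact: H.
Qed.

Lemma iter_wlapZ k m c u : sobolev (k.*2 + m) u ->
  ae_eq leb Omega (iter k wlap (fun x => c * u x)) (fun x => c * iter k wlap u x).
Proof.
elim: k u => [|k IH] u su; first exact: ae_eq_refl.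
have E : ae_eq leb Omega (wlap (fun x => c * u x)) (fun x => c * wlap u x).
  have : \forall x \ae leb, forall i, Omega x ->
      wderiv [:: i; i] (fun x => c * u x) x = c * wderiv [:: i; i] u x.
    by apply: filter_forall => i; exact: (wderivZ_ae c su).
  by apply: filterS => x H Ox; rewrite /Defs.wlap mulr_sumr; apply: eq_bigr => i _; exact: H.
rewrite !iterSr; apply: ae_eq_trans (IH _ (sobolev_wlap su)).
case: k {IH su} => [|k]; first exact: E.
rewrite !iterSr; set a := wlap (wlap _); set b := wlap _.
suff -> : a = b by exact: ae_eq_refl.
apply/funext => x; apply: eq_bigr => i _.
by rewrite (wderiv_ae_eq [:: i; i] (L2_wlap _) (L2Z mO c (L2_wlap _)) E).
Qed.

End weak.

(** * Approximation by test functions *)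

Section approx.
Context (R : realType) (n : nat) (Omega : set 'rV[R]_n) (M : R).
Hypotheses (oO : open Omega) (OM : Omega `<=` cube M).
Implicit Types (u v w phi psi : 'rV[R]_n -> R) (i j : 'I_n) (s t : seq 'I_n).

Local Notation leb := (lebesgue_rV R n).
Local Notation L2 := (L2 Omega).
Local Notation test := (test_fun Omega).
Local Notation dot := (L2dot Omega).
Local Notation wderiv := (wderiv Omega).
Local Notation is_wderiv := (is_wderiv Omega).
Local Notation sobolev := (sobolev Omega).
Local Notation sobolev0 := (sobolev0 Omega).
Local Notation wlap := (wlap Omega).
Local Notation ip := (ip Omega).
Local Notation sip := (smooth_ip Omega).

Let mO : measurable Omega := domain_measurable oO.
Let Ofin : (leb Omega < +oo)%E := domain_fin oO OM.

Definition dist2 u v : R := dot (fun x => u x - v x) (fun x => u x - v x).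

Lemma dist2_ge0 u v : 0 <= dist2 u v. Proof. exact: dot_ge0. Qed.

Lemma dist2_ae u u' v v' : L2 u -> L2 u' -> L2 v -> L2 v' ->
  ae_eq leb Omega u u' -> ae_eq leb Omega v v' -> dist2 u v = dist2 u' v'.
Proof.
move=> Lu Lu' Lv Lv' uu' vv'; rewrite /dist2.
have E : ae_eq leb Omega (fun x => u x - v x) (fun x => u' x - v' x).
  by apply: filterS2 uu' vv' => x H1 H2 Ox; rewrite H1// H2.
have L1 : L2 (fun x => u x - v x) by exact: L2B.
have L1' : L2 (fun x => u' x - v' x) by exact: L2B.
by rewrite (L2_ae_eq_dot mO L1 L1' L1 E) dotC (L2_ae_eq_dot mO L1 L1' L1' E).
Qed.

Lemma dot_sum_le (f : 'I_n -> 'rV[R]_n -> R) : (forall j, L2 (f j)) ->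
  dot (fun x => \sum_j f j x) (fun x => \sum_j f j x) <= n%:R * \sum_j dot (f j) (f j).
Proof.
move=> Lf; pose F x := \sum_j f j x.
have LF : L2 F by exact: L2_sum.
have := @dot_sum_CS _ _ _ mO _ f (fun=> F) Lf (fun=> LF).
rewrite -(dot_suml mO Ofin _ LF Lf) sumr_const card_ord -/F -[_ *+ n]mulr_natl.
have := dot_ge0 Omega F; rewrite le_eqVlt => /predU1P[<- _|F0].
  by rewrite mulr_ge0// sumr_ge0// => j _; exact: dot_ge0.
by rewrite expr2 mulrA ler_pM2r// mulrC.
Qed.

(** All weak derivatives up to order m at squared distance at most e from those of phi. It is
preserved, up to a constant, by the iterated Laplacian, whereas the chosen representatives are
additive only almost everywhere. *)
Definition close m u phi (e : R) := forall s, (size s <= m)%N ->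
  dist2 (wderiv s u) (pderivs s phi) <= e.

Lemma wderiv_sub_test m s u phi : sobolev m u -> test phi -> (size s <= m)%N ->
  ae_eq leb Omega (wderiv s (u \- phi)) (fun x => wderiv s u x - pderivs s phi x).
Proof.
move=> su tp sm; have sp := test_smooth tp.
have Lw := L2_wderiv oO OM s u; have Lp := L2_smooth oO OM (smooth_pderivs s sp).
apply: (wderiv_ae oO OM); first exact: L2B.
apply: (is_wderivB oO OM) => //; [exact: su.1|exact: (L2_smooth oO OM)| |].
- exact: sobolevP su sm.
- exact: (smooth_wderiv oO OM).
Qed.

Lemma sobolev_normE m u phi : sobolev m u -> test phi ->
  sobolev_norm Omega m (u \- phi) =
  Num.sqrt (\sum_(k < m.+1) \sum_(s : k.-tuple 'I_n) dist2 (wderiv s u) (pderivs s phi)).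
Proof.
move=> su tp; congr Num.sqrt; apply: eq_bigr => k _; apply: eq_bigr => s _.
have sm : (size s <= m)%N by rewrite size_tuple -ltnS.
have E := wderiv_sub_test su tp sm.
have Lw := L2_wderiv oO OM s (u \- phi).
have Lw' := L2B mO (L2_wderiv oO OM s u) (L2_smooth oO OM (smooth_pderivs s (test_smooth tp))).
rewrite -[LHS]/(dot (wderiv s (u \- phi)) (wderiv s (u \- phi))).
by rewrite (L2_ae_eq_dot mO Lw Lw' Lw E) dotC (L2_ae_eq_dot mO Lw Lw' Lw' E).
Qed.

Lemma sobolev0_close m u e : sobolev0 m u -> 0 < e ->
  exists2 phi, test phi & close m u phi e.
Proof.
move=> [su H] e0; have se0 : 0 < Num.sqrt e by rewrite sqrtr_gt0.
have [phi [tp]] := H _ se0; rewrite (sobolev_normE su tp) ltr_sqrt// => Hlt.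
exists phi => // s sm; apply: le_trans (ltW Hlt).
rewrite (bigD1 (Ordinal (sm : (size s < m.+1)%N)))//= (bigD1 (in_tuple s))//=.
rewrite -addrA lerDl addr_ge0// sumr_ge0// => k _;
  last by rewrite sumr_ge0// => t _; exact: dist2_ge0.
exact: dist2_ge0.
Qed.

Lemma close_sobolev0 m u : sobolev m u ->
  (forall e : R, 0 < e -> exists2 phi, test phi & close m u phi e) -> sobolev0 m u.
Proof.
move=> su H; split=> // e e0.
pose N : R := \sum_(k < m.+1) \sum_(s : k.-tuple 'I_n) 1.
have N0 : 0 <= N by rewrite sumr_ge0// => k _; rewrite sumr_ge0.
have e'0 : 0 < e ^+ 2 / (N + 1) by rewrite divr_gt0 ?exprn_gt0 ?ltr_wpDl.
have [phi tp cl] := H _ e'0; exists phi; split=> //.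
rewrite (sobolev_normE su tp) -[ltRHS](ger0_norm (ltW e0)) -sqrtr_sqr ltr_sqrt ?exprn_gt0//.
apply: (@le_lt_trans _ _ (N * (e ^+ 2 / (N + 1)))).
  rewrite mulr_suml; apply: ler_sum => k _; rewrite mulr_suml; apply: ler_sum => s _.
  by rewrite mul1r; apply: cl; rewrite size_tuple -ltnS.
by rewrite mulrCA gtr_pMr ?exprn_gt0// ltr_pdivrMr ?ltr_wpDl// mul1r ltrDl.
Qed.

Lemma close_dist2 m u phi e : L2 u -> test phi -> close m u phi e -> dist2 u phi <= e.
Proof.
move=> Lu tp /(_ [::] isT); rewrite (@dist2_ae _ u _ phi)//.
- exact: (L2_wderiv oO OM).
- exact: (L2_test oO OM).
- exact: (L2_test oO OM).
- apply: (wderiv_ae oO OM) => // psi _; by rewrite /= expr0 mul1r.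
- exact: ae_eq_refl.
Qed.

Lemma sobolev0_wderiv1 m i u : sobolev0 m.+1 u -> sobolev0 m (wderiv [:: i] u).
Proof.
move=> su; have ex : exists v, L2 v /\ is_wderiv [:: i] u v by apply: su.1.2.
apply: close_sobolev0; first exact: (@sobolev_wderiv _ _ _ _ oO OM m [:: i] u su.1).
move=> e e0; have [phi tp cl] := sobolev0_close su e0.
exists (pderiv i phi); first exact: (test_pderiv i tp).
move=> s sm; rewrite (wderiv_cat s ex) /=.
rewrite (pderivs_pderiv s i (test_smooth tp)).
exact: (cl (i :: s)).
Qed.

Lemma sobolev0_test m phi : test phi -> sobolev0 m phi.
Proof.
move=> tp; apply: close_sobolev0.
  exact: (sobolev_smooth oO OM _ (test_smooth tp)).
move=> e e0; exists phi => // s _.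
have sp := test_smooth tp.
have Lp := L2_smooth oO OM (smooth_pderivs s sp).
rewrite (dist2_ae _ Lp Lp Lp (wderiv_smooth oO OM s sp) (ae_eq_refl _ _ _)).
  rewrite /dist2 (@eq_dot _ _ _ _ _ (cst 0) (cst 0)) ?dot0l ?ltW//.
  by move=> x _; rewrite subrr.
  by move=> x _; rewrite subrr.
exact: (L2_wderiv oO OM).
Qed.

Lemma sobolev0Z m c u : sobolev0 m u -> sobolev0 m (fun x => c * u x).
Proof.
move=> su; apply: close_sobolev0; first exact: (sobolevZ oO OM c su.1).
move=> e e0; have e'0 : 0 < e / (c ^+ 2 + 1) by rewrite divr_gt0// ltr_wpDl ?sqr_ge0.
have [phi tp cl] := sobolev0_close su e'0.
exists (fun x => c * phi x); first exact: test_scale.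
move=> s sm; have sp := test_smooth tp.
have -> : pderivs s (fun x => c * phi x) = (fun x => c * pderivs s phi x).
  elim: s {sm} => [//|i s IH].
  transitivity (pderiv i (fun x => c * pderivs s phi x)); first by rewrite -IH.
  exact: (pderivZ i c (smooth_pderivs s sp)).
have Lp := L2_smooth oO OM (smooth_pderivs s sp).
have Lw := L2_wderiv oO OM s u.
have Lcp := L2Z mO c Lp; have Lcw := L2Z mO c Lw.
rewrite (dist2_ae (L2_wderiv oO OM s _) Lcw Lcp Lcp (wderivZ_ae oO OM c su.1 sm)
  (ae_eq_refl _ _ _)).
have -> : dist2 (fun x => c * wderiv s u x) (fun x => c * pderivs s phi x) =
    c ^+ 2 * dist2 (wderiv s u) (pderivs s phi).
  have LB := L2B mO Lw Lp.
  rewrite /dist2 expr2 -mulrA -(dotZr mO c LB LB) -(dotZl mO c _ LB); last exact: L2Z.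
  by apply: eq_dot => x _; rewrite mulrBr.
apply: (@le_trans _ _ (c ^+ 2 * (e / (c ^+ 2 + 1)))).
  by rewrite ler_wpM2l ?sqr_ge0// cl.
rewrite mulrCA ger_pMr// ler_pdivrMr ?ltr_wpDl ?sqr_ge0// mul1r lerDl//.
Qed.

Lemma close_wlap m u phi e : sobolev m.+2 u -> test phi ->
  close m.+2 u phi e -> close m (wlap u) (lap phi) (n%:R * (n%:R * e)).
Proof.
move=> su tp cl s sm; have sp := test_smooth tp.
rewrite (pderivs_lap s sp).
have Lw i : L2 (wderiv (i :: i :: s) u) by exact: (L2_wderiv oO OM).
have Lp i : L2 (pderivs (i :: i :: s) phi).
  exact: (L2_smooth oO OM (smooth_pderivs (i :: i :: s) sp)).
have LSw := L2_sum mO Ofin (index_enum 'I_n) Lw.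
have LSp := L2_sum mO Ofin (index_enum 'I_n) Lp.
rewrite (dist2_ae (L2_wderiv oO OM s _) LSw LSp LSp _ (ae_eq_refl _ _ _)); last first.
  by apply: (wderiv_ae oO OM) => //; exact: (is_wderiv_wlap oO OM su sm).
have LB i := L2B mO (Lw i) (Lp i).
rewrite /dist2 (@eq_dot _ _ _ _ _
  (fun x => \sum_i (wderiv (i :: i :: s) u x - pderivs (i :: i :: s) phi x))
  (fun x => \sum_i (wderiv (i :: i :: s) u x - pderivs (i :: i :: s) phi x))); last 2 first.
- by move=> x _; rewrite sumrB.
- by move=> x _; rewrite sumrB.
apply: (le_trans (dot_sum_le LB)); rewrite ler_wpM2l//.
rewrite (le_trans (ler_sum _ (fun i _ => cl (i :: i :: s) _)))//.
by rewrite sumr_const card_ord mulr_natl.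
Qed.

Lemma close_iter_wlap k m u phi e : sobolev (k.*2 + m) u -> test phi ->
  close (k.*2 + m) u phi e ->
  close m (iter k wlap u) (iter k (@lap R n) phi) (n%:R ^+ k.*2 * e).
Proof.
elim: k u phi e => [|k IH] u phi e su tp cl; first by rewrite expr0 mul1r.
rewrite !iterSr doubleS !exprSr -!mulrA; apply: IH.
- exact: (sobolev_wlap oO OM su).
- exact: test_lap.
- exact: close_wlap.
Qed.

Lemma ipE m u v : sobolev m u -> sobolev m v -> ip m u v =
  if odd m then \sum_i dot (wderiv [:: i] (iter m./2 wlap u)) (wderiv [:: i] (iter m./2 wlap v))
  else dot (iter m./2 wlap u) (iter m./2 wlap v).
Proof.
move=> su sv; rewrite /Defs.ip; case: ifP => // _.
have Ld w i : L2 (wderiv [:: i] (iter m./2 wlap w)) by exact: (L2_wderiv oO OM).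
rewrite -(big_enum _ _ _ _)/=.
under eq_Rintegral => x _ do rewrite -(big_enum _ _ _ _)/=.
elim: (enum _) => [|i r IH].
  rewrite big_nil (@eq_Rintegral _ _ _ _ _ (cst 0)); first by rewrite Rintegral_cst// mul0r.
  by move=> x _; rewrite big_nil.
rewrite big_cons -IH /dot -RintegralD//; first by apply: eq_Rintegral => x _; rewrite big_cons.
  exact: (L2_mul mO (Ld u i) (Ld v i)).
have := @integrable_sum _ _ _ leb Omega mO 'I_n r xpredT
  (fun i x => (wderiv [:: i] (iter m./2 wlap u) x * wderiv [:: i] (iter m./2 wlap v) x)%:E)
  (fun i _ => L2_mul mO (Ld u i) (Ld v i)).
by apply: eq_integrable => // x _ /=; rewrite sumEFin.
Qed.

Lemma sobolev_iter_wlap_L2 m u : sobolev m u -> L2 (iter m./2 wlap u).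
Proof. by move=> su; apply: (L2_iter_wlap oO OM); exact: su.1. Qed.

Lemma ip_ge0 m u : sobolev m u -> 0 <= ip m u u.
Proof.
move=> su; rewrite ipE//; case: ifP => _; last exact: dot_ge0.
by apply: sumr_ge0 => i _; exact: dot_ge0.
Qed.

Lemma norm0_sqr m u : sobolev m u -> norm0 Omega m u ^+ 2 = ip m u u.
Proof. by move=> su; rewrite /norm0 sqr_sqrtr// ip_ge0. Qed.

Lemma ip_CS m u v : sobolev m u -> sobolev m v -> ip m u v ^+ 2 <= ip m u u * ip m v v.
Proof.
move=> su sv; rewrite !ipE//; case: ifP => _.
  by apply: (dot_sum_CS mO) => i; exact: (L2_wderiv oO OM).
by apply: (dot_CS mO); exact: sobolev_iter_wlap_L2.
Qed.

Lemma smooth_ipE m u : smooth u -> ip m u u = sip m u.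
Proof.
move=> su; have so : sobolev m u := sobolev_smooth oO OM m su.
rewrite ipE// /smooth_ip.
have sl := smooth_iter_lap m./2 su.
have E := iter_wlap_smooth oO OM m./2 su.
have L1 : L2 (iter m./2 wlap u) := sobolev_iter_wlap_L2 so.
have L1' : L2 (iter m./2 (@lap R n) u) := L2_smooth oO OM sl.
case: ifP => _; last first.
  by rewrite (L2_ae_eq_dot mO L1 L1' L1 E) dotC (L2_ae_eq_dot mO L1 L1' L1' E).
apply: eq_bigr => i _; rewrite (wderiv_ae_eq oO OM [:: i] L1 L1' E).
have E' := wderiv_smooth oO OM [:: i] sl.
have L3 := L2_wderiv oO OM [:: i] (iter m./2 (@lap R n) u).
have L3' := L2_smooth oO OM (smooth_pderiv i sl).
by rewrite (L2_ae_eq_dot mO L3 L3' L3 E') dotC (L2_ae_eq_dot mO L3 L3' L3' E').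
Qed.

Lemma ipZ m c u : sobolev m u -> ip m (fun x => c * u x) (fun x => c * u x) = c ^+ 2 * ip m u u.
Proof.
move=> su; have scu : sobolev m (fun x => c * u x) := sobolevZ oO OM c su.
rewrite !ipE//.
have su' : sobolev (m./2.*2 + odd m) u by rewrite addnC odd_double_half.
have E := iter_wlapZ oO OM c su'.
have sl := sobolev_iter_wlap oO OM su'.
have L1 := sobolev_iter_wlap_L2 scu.
have L1' := L2Z mO c (sobolev_iter_wlap_L2 su).
case: ifP => om; last first.
  have LL := sobolev_iter_wlap_L2 su.
  rewrite (L2_ae_eq_dot mO L1 L1' L1 E) dotC (L2_ae_eq_dot mO L1 L1' L1' E).
  by rewrite (dotZl mO c L1' LL) (dotZr mO c LL LL) mulrA expr2.
rewrite mulr_sumr; apply: eq_bigr => i _.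
rewrite (wderiv_ae_eq oO OM [:: i] L1 L1' E).
rewrite om in sl.
have E' := wderivZ_ae oO OM c sl (isT : (size [:: i] <= 1)%N).
have L3 := L2_wderiv oO OM [:: i] (fun x => c * iter m./2 wlap u x).
have L4 := L2_wderiv oO OM [:: i] (iter m./2 wlap u).
have L3' := L2Z mO c L4.
rewrite (L2_ae_eq_dot mO L3 L3' L3 E') dotC (L2_ae_eq_dot mO L3 L3' L3' E').
by rewrite (dotZl mO c L3' L4) (dotZr mO c L4 L4) mulrA expr2.
Qed.

Lemma smooth_ip_close m u phi e d : (0 < n)%N -> sobolev m u -> test phi -> 0 <= e -> 0 < d ->
  close m u phi e ->
  sip m phi <= (1 + d) * ip m u u + (1 + d^-1) * (n%:R * n%:R ^+ m * e + n%:R ^+ m * e).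
Proof.
move=> n0 su tp e0 d0 cl; rewrite ipE// /smooth_ip.
have d1 : 0 <= 1 + d^-1 by rewrite addr_ge0// invr_ge0 ltW.
have mE : (m./2.*2 + odd m)%N = m by rewrite addnC odd_double_half.
have [su' cl'] : sobolev (m./2.*2 + odd m) u /\ close (m./2.*2 + odd m) u phi e by rewrite mE.
have cw := close_iter_wlap su' tp cl'.
have tl := test_iter_lap m./2 tp.
have sl := test_smooth tl.
have L1 := sobolev_iter_wlap_L2 su.
have L2' := L2_smooth oO OM sl.
case: ifP => om; rewrite om ?addn0 ?addn1 in cw mE.
- have ee : n%:R ^+ m./2.*2 * e <= n%:R ^+ m * e.
    rewrite ler_wpM2r// -[in leRHS]mE exprSr.
    by rewrite ler_peMr ?exprn_ge0// ler1n.
  have H i : dot (pderiv i (iter m./2 (@lap R n) phi)) (pderiv i (iter m./2 (@lap R n) phi)) <=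
     (1 + d) * dot (wderiv [:: i] (iter m./2 wlap u)) (wderiv [:: i] (iter m./2 wlap u)) +
     (1 + d^-1) * (n%:R ^+ m * e).
    have L3 := L2_wderiv oO OM [:: i] (iter m./2 wlap u).
    have L4 := L2_smooth oO OM (smooth_pderiv i sl).
    apply: (le_trans (dot_perturb mO L3 L4 d0)).
    by rewrite lerD2l ler_wpM2l// (le_trans (cw [:: i] isT)).
  apply: (le_trans (ler_sum _ (fun i _ => H i))).
  rewrite big_split/= -mulr_sumr lerD2l sumr_const card_ord.
  rewrite -[(_ * _) *+ n]mulr_natl mulrCA ler_wpM2l//.
  by rewrite mulrA lerDl mulr_ge0// exprn_ge0.
- apply: (le_trans (dot_perturb mO L1 L2' d0)).
  rewrite lerD2l ler_wpM2l//.
  rewrite (le_trans (close_dist2 L1 tl cw))// mE lerDr !mulr_ge0// exprn_ge0//.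
Qed.

(** The only form in which density of test functions is used for the scalar product: an L^2
estimate by smooth_ip on test functions passes to all of H^m_0. *)
Lemma sobolev0_smooth_ip_approx m u e : (0 < n)%N -> sobolev0 m u -> 0 < e ->
  exists2 phi, test phi & dist2 u phi <= e /\ sip m phi <= ip m u u + e.
Proof.
move=> n0 su e0; have A0 := ip_ge0 su.1; set A := ip m u u in A0 *.
pose d := e / 2 / (A + 1).
have d0 : 0 < d by rewrite !divr_gt0// ltr_wpDl.
pose K : R := n%:R * n%:R ^+ m + n%:R ^+ m.
have K0 : 0 <= K by rewrite addr_ge0 ?mulr_ge0 ?exprn_ge0.
have d1 : 0 < 1 + d^-1 by rewrite addr_gt0 ?invr_gt0.
have D0 : 0 < (1 + d^-1) * (K + 1) by rewrite mulr_gt0// ltr_wpDl.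
pose e' := Num.min e (e / 2 / ((1 + d^-1) * (K + 1))).
have e'0 : 0 < e' by rewrite lt_min e0 !divr_gt0.
have [phi tp cl] := sobolev0_close su e'0.
exists phi => //; split.
  by apply: (le_trans (close_dist2 su.1.1 tp cl)); rewrite ge_min lexx.
apply: (le_trans (smooth_ip_close n0 su.1 tp (ltW e'0) d0 cl)).
rewrite -/A mulrDl mul1r -addrA lerD2l [leRHS]splitr lerD//.
  by rewrite /d mulrAC ler_pdivrMr ?ltr_wpDl// ler_wpM2l ?divr_ge0 ?ltW// ltrDl.
rewrite -mulrDl -/K.
apply: (@le_trans _ _ ((1 + d^-1) * (K + 1) * e')).
  rewrite -mulrA ler_wpM2l ?addr_ge0 ?invr_ge0 ?(ltW d0)// ler_wpM2r ?(ltW e'0)//.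
  by rewrite lerDl.
by rewrite mulrC -ler_pdivlMr// ge_min lexx orbT.
Qed.

End approx.

(** * Energy identity and Poincare inequality *)

(** Sends first e, then d to zero; the hypothesis has the shape produced by dot_perturb. *)
Lemma le_of_perturb (R : realFieldType) (x A B D : R) : 0 <= A -> 0 <= B -> 0 <= D ->
  (forall d e : R, 0 < d -> 0 < e -> x <= (1 + d) * (A + B * e) + (1 + d^-1) * (D * e)) ->
  x <= A.
Proof.
move=> A0 B0 D0 H; apply/ler_addgt0Pl => eps eps0.
pose d := eps / 2 / (A + 1).
have d0 : 0 < d by rewrite !divr_gt0// ltr_wpDl.
pose K := (1 + d) * B + (1 + d^-1) * D.
have K0 : 0 <= K by rewrite addr_ge0// mulr_ge0// addr_ge0 ?invr_ge0 ?(ltW d0).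
pose e := eps / 2 / (K + 1).
have e0 : 0 < e by rewrite !divr_gt0// ltr_wpDl.
have dA : d * A <= eps / 2.
  by rewrite /d mulrAC ler_pdivrMr ?ltr_wpDl// ler_wpM2l ?divr_ge0 ?ltW// ltrDl.
have eK : e * K <= eps / 2.
  by rewrite /e mulrAC ler_pdivrMr ?ltr_wpDl// ler_wpM2l ?divr_ge0 ?ltW// ltrDl.
apply: (le_trans (H d e d0 e0)).
rewrite [leLHS](_ : _ = A + d * A + e * K); last by rewrite /K; ring.
by rewrite -addrA [leRHS]addrC lerD2l [leRHS]splitr lerD.
Qed.

Section identities.
Context (R : realType) (n : nat) (Omega : set 'rV[R]_n) (M : R).
Hypotheses (oO : open Omega) (OM : Omega `<=` cube M).
Implicit Types (u v w phi psi : 'rV[R]_n -> R) (i j : 'I_n) (s t : seq 'I_n).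

Local Notation leb := (lebesgue_rV R n).
Local Notation L2 := (L2 Omega).
Local Notation test := (test_fun Omega).
Local Notation dot := (L2dot Omega).
Local Notation wderiv := (wderiv Omega).
Local Notation sobolev0 := (sobolev0 Omega).
Local Notation ip := (ip Omega).
Local Notation sip := (smooth_ip Omega).

Let mO : measurable Omega := domain_measurable oO.
Let Ofin : (leb Omega < +oo)%E := domain_fin oO OM.

(** Two integrations by parts and the symmetry of third derivatives. *)
Lemma dot_hessian i j phi : test phi ->
  dot (pderiv j (pderiv i phi)) (pderiv j (pderiv i phi)) =
  dot (pderiv i (pderiv i phi)) (pderiv j (pderiv j phi)).
Proof.
move=> tp; have sp := test_smooth tp.
have ti := test_pderiv i tp; have si := test_smooth ti.
have tj := test_pderiv j tp; have sj := test_smooth tj.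
have tjj := test_pderiv j tj.
have C : pderiv j (pderiv j (pderiv i phi)) = pderiv i (pderiv j (pderiv j phi)).
  by rewrite (pderivC j i sp); exact (pderivC j i sj).
have E1 := by_parts oO OM j (smooth_pderiv j si) ti.
have E2 := by_parts oO OM i si tjj.
exact (etrans E1 (etrans (congr1 -%R (etrans (dotC Omega _ _) (congr1 (dot (pderiv i phi)) C)))
  (etrans (congr1 -%R E2) (opprK _)))).
Qed.

(** The identity sum_i |d_i phi|_m^2 = |phi|_(m+1)^2. For even m it only commutes d_i with the
Laplacian; for odd m it says that the Hessian and the Laplacian of Delta^k phi have the same
norm. *)
Lemma smooth_ip_gradient m phi : test phi ->
  \sum_i sip m (pderiv i phi) = sip m.+1 phi.
Proof.
move=> tp; have sp := test_smooth tp.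
rewrite /smooth_ip /= uphalf_half; case: (odd m) => /=; last first.
  by apply: eq_bigr => i _; rewrite add0n (pderiv_iter_lap _ _ sp).
rewrite add0n; have tl := test_iter_lap m./2 tp.
move: (iter m./2 (@lap R n) phi) tl (fun i => @pderiv_iter_lap R n m./2 i phi sp) => th tth E.
have L2d i j : L2 (pderiv i (pderiv j th)).
  exact: (L2_smooth oO OM (smooth_pderiv i (smooth_pderiv j (test_smooth tth)))).
rewrite (dot_suml mO Ofin _ (L2_sum mO Ofin _ (fun i => L2d i i)) (fun i => L2d i i)).
apply: eq_bigr => i _; rewrite (dot_sumr mO Ofin _ (L2d i i) (fun j => L2d j j)).
by apply: eq_bigr => j _; rewrite -E; exact: dot_hessian.
Qed.

Lemma smooth_ip_ge0 m phi : 0 <= sip m phi.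
Proof.
rewrite /smooth_ip; case: ifP => _; last exact: dot_ge0.
by apply: sumr_ge0 => i _; exact: dot_ge0.
Qed.

Lemma smooth_coord i : smooth (fun x : 'rV[R]_n => x 0 i).
Proof.
have := @smooth_affine_comp R n id i 1 0 (fun N => id_Ck R N).
rewrite (_ : (fun x => _) = (fun x : 'rV[R]_n => x 0 i))//.
by apply/funext => x /=; rewrite mul1r addr0.
Qed.

Lemma pderiv_coord i j : pderiv j (fun x : 'rV[R]_n => x 0 i) = cst (j == i)%:R.
Proof.
rewrite (pderiv_coord_comp j i (fun h : R => is_derive_id h 1)).
by apply/funext => x; rewrite mulr1.
Qed.

(** Integrate phi^2 = phi^2 d_i(x_i) by parts, and use |x_i| <= M. *)
Lemma poincare1 i phi : test phi ->
  dot phi phi <= 4 * M ^+ 2 * dot (pderiv i phi) (pderiv i phi).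
Proof.
move=> tp; have sp := test_smooth tp.
pose X (x : 'rV[R]_n) := x 0 i.
have sX : smooth X := smooth_coord i.
have LX := L2_smooth oO OM sX.
have sdp := smooth_pderiv i sp.
have Lp := L2_smooth oO OM sp; have Ldp := L2_smooth oO OM sdp.
have LXp : L2 (X \* phi) := L2_smooth oO OM (smoothM sX sp).
have := by_parts oO OM i sX (test_mul sp tp).
rewrite (pderivM i sp sp) pderiv_coord eqxx.
have -> : dot (cst 1) (phi \* phi) = dot phi phi.
  by apply: eq_Rintegral => x _ /=; rewrite mul1r.
have -> : dot X (fun x => phi x * pderiv i phi x + phi x * pderiv i phi x) =
    2 * dot (X \* phi) (pderiv i phi).
  rewrite -(dotZl mO 2 Ldp LXp).
  by apply: eq_Rintegral => x _ /=; rewrite /X; ring.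
move=> E.
have XX : dot (X \* phi) (X \* phi) <= M ^+ 2 * dot phi phi.
  rewrite /dot -RintegralZl//; last exact: (L2_mul mO Lp Lp).
  apply: le_Rintegral => //; first exact: (L2_mul mO LXp LXp).
    have := integrableZl mO (M ^+ 2) (L2_mul mO Lp Lp).
    by apply: eq_integrable => // x _; rewrite /= EFinM.
  move=> x Ox; rewrite /= mulrACA -!expr2 ler_wpM2r ?sqr_ge0//.
  rewrite -(real_normK (num_real (X x))) ler_pXn2r ?nnegrE//; first exact: OM.
  by rewrite (le_trans _ (OM Ox i)).
have CS := dot_CS mO LXp Ldp.
have p0 := dot_ge0 Omega phi; have dp0 := dot_ge0 Omega (pderiv i phi).
move: E XX CS p0 dp0; set a := dot phi phi; set b := dot (X \* phi) _.
set c := dot (X \* phi) (X \* phi); set d := dot (pderiv i phi) _ => E XX CS a0 d0.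
have [->|an0] := eqVneq a 0; first by rewrite mulr_ge0// mulr_ge0// sqr_ge0.
have ap : 0 < a by rewrite lt_neqAle eq_sym an0.
rewrite -(ler_pM2l ap).
have -> : a = - (2 * b) by rewrite E opprK.
have -> : - (2 * b) * - (2 * b) = 4 * b ^+ 2 by ring.
apply: (@le_trans _ _ (4 * (c * d))); first by rewrite ler_wpM2l.
apply: (@le_trans _ _ (4 * (M ^+ 2 * a * d))); first by rewrite ler_wpM2l// ler_wpM2r.
by rewrite E opprK le_eqVlt; apply/orP; left; apply/eqP; ring.
Qed.

Lemma poincare (i : 'I_n) m phi : test phi -> dot phi phi <= (4 * M ^+ 2) ^+ m * sip m phi.
Proof.
have K0 : 0 <= 4 * M ^+ 2 by rewrite mulr_ge0 ?sqr_ge0.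
elim: m phi => [|m IH] phi tp; first by rewrite expr0 mul1r.
apply: (le_trans (poincare1 i tp)); rewrite [_ ^+ m.+1]exprS -[leRHS]mulrA ler_wpM2l//.
apply: (le_trans (IH _ (test_pderiv i tp))); rewrite ler_wpM2l ?exprn_ge0//.
rewrite -(smooth_ip_gradient m tp) (bigD1 i)//= lerDl.
by apply: sumr_ge0 => j _; exact: smooth_ip_ge0.
Qed.

Lemma poincare_sobolev0 (i : 'I_n) m u : sobolev0 m u ->
  dot u u <= (4 * M ^+ 2) ^+ m * ip m u u.
Proof.
move=> su; have n0 : (0 < n)%N by case: i => k; exact: leq_ltn_trans.
have C0 : 0 <= (4 * M ^+ 2) ^+ m by rewrite exprn_ge0// mulr_ge0 ?sqr_ge0.
apply: (@le_of_perturb _ _ _ ((4 * M ^+ 2) ^+ m) 1) => //.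
  by rewrite mulr_ge0// (ip_ge0 oO OM su.1).
move=> d e d0 e0.
have [phi tp [up cp]] := sobolev0_smooth_ip_approx oO OM n0 su e0.
have Lp := L2_test oO OM tp; have Lu := su.1.1.
have d1 : 0 <= 1 + d by rewrite addr_ge0// ltW.
apply: (le_trans (dot_perturb mO Lp Lu d0)); rewrite lerD//.
  rewrite ler_wpM2l// -mulrDr (le_trans (poincare i m tp))// ler_wpM2l//.
rewrite ler_wpM2l ?addr_ge0 ?invr_ge0 ?(ltW d0)// mul1r.
apply: le_trans up; rewrite le_eqVlt; apply/orP; left; apply/eqP.
by apply: eq_Rintegral => x _; ring.
Qed.

(** Keeps the constant l sharp, which the lower bound n requires. *)
Lemma sqr_mean_sobolev0_le m u (l : R) : (0 < n)%N -> 0 <= l ->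
  (forall phi, test phi -> dot (cst 1) phi ^+ 2 <= l * sip m phi) ->
  sobolev0 m u -> dot (cst 1) u ^+ 2 <= l * ip m u u.
Proof.
move=> n0 l0 H su; have L1 : L2 (cst 1) by exact: L2_cst.
apply: (@le_of_perturb _ _ _ l (dot (cst 1) (cst 1))) => //.
- by rewrite mulr_ge0// (ip_ge0 oO OM su.1).
- exact: dot_ge0.
move=> d e d0 e0.
have [phi tp [up cp]] := sobolev0_smooth_ip_approx oO OM n0 su e0.
have Lp := L2_test oO OM tp; have Lu := su.1.1.
have LB := L2B mO Lu Lp.
have CS := dot_CS mO L1 LB; have Hp := H _ tp.
have d1 : 0 <= 1 + d by rewrite addr_ge0// ltW.
have d2 : 0 <= 1 + d^-1 by rewrite addr_ge0// invr_ge0 ltW.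
have E : dot (cst 1) u = dot (cst 1) phi + dot (cst 1) (fun x => u x - phi x).
  by rewrite (dotBr mO L1 Lu Lp); ring.
apply: (@le_trans _ _ ((1 + d) * dot (cst 1) phi ^+ 2 +
    (1 + d^-1) * dot (cst 1) (fun x => u x - phi x) ^+ 2)).
  rewrite E; move: (dot _ phi) (dot _ (fun x => u x - phi x)) => a b.
  rewrite -subr_ge0 -(pmulr_rge0 _ d0).
  rewrite (_ : d * _ = (d * a - b) ^+ 2) ?sqr_ge0//.
  by field; rewrite gt_eqF.
rewrite lerD// ler_wpM2l//.
  by rewrite -mulrDr (le_trans Hp)// ler_wpM2l.
by rewrite (le_trans CS)// ler_wpM2l ?dot_ge0.
Qed.

Lemma by_parts_sobolev0 m j u w : smooth w -> sobolev0 m.+1 u ->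
  dot w (wderiv [:: j] u) = - dot (pderiv j w) u.
Proof.
move=> sw su; have Lw := L2_smooth oO OM sw; have Ldw := L2_smooth oO OM (smooth_pderiv j sw).
apply/eqP; rewrite -addr_eq0 -sqrf_eq0 eq_le sqr_ge0 andbT.
set A := dot w w; set B := dot (pderiv j w) (pderiv j w).
(* The square of the defect is bounded by a multiple of e for every e > 0. *)
apply: (@le_of_perturb _ _ 0 B A) => //; try exact: dot_ge0.
move=> d e d0 e0.
have [phi tp cl] := sobolev0_close oO OM su e0.
have sp := test_smooth tp.
have Lp := L2_test oO OM tp; have Lu := su.1.1.
have Ldp := L2_smooth oO OM (smooth_pderiv j sp).
have Ldu := L2_wderiv oO OM [:: j] u.
have c0 := close_dist2 oO OM Lu tp cl.
have c1 := cl [:: j] isT.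
have E : dot w (wderiv [:: j] u) + dot (pderiv j w) u =
    dot w (fun x => wderiv [:: j] u x - pderiv j phi x) + dot (pderiv j w) (fun x => u x - phi x).
  by rewrite (dotBr mO Lw Ldu Ldp) (dotBr mO Ldw Lu Lp) (by_parts oO OM j sw tp); ring.
have CS1 := dot_CS mO Lw (L2B mO Ldu Ldp).
have CS2 := dot_CS mO Ldw (L2B mO Lu Lp).
rewrite E.
have h1 : dot w (fun x => wderiv [:: j] u x - pderiv j phi x) ^+ 2 <= A * e.
  by rewrite (le_trans CS1)// ler_wpM2l ?dot_ge0.
have h2 : dot (pderiv j w) (fun x => u x - phi x) ^+ 2 <= B * e.
  by rewrite (le_trans CS2)// ler_wpM2l ?dot_ge0.
move: h1 h2; set a := dot w _; set b := dot _ _ => h1 h2.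
apply: (@le_trans _ _ ((1 + d) * b ^+ 2 + (1 + d^-1) * a ^+ 2)).
  rewrite -subr_ge0 -(pmulr_rge0 _ d0).
  rewrite (_ : d * _ = (d * b - a) ^+ 2) ?sqr_ge0//.
  by field; rewrite gt_eqF.
by rewrite add0r lerD// ler_wpM2l// addr_ge0 ?invr_ge0 ?(ltW d0).
Qed.

End identities.

(** * Testing against functions of one variable *)

Section simple_approximation.
Import HBNNSimple.

(** Approximating the identity of the line, instead of a function g on Omega, yields simple functions
of g whose level sets are preimages of Borel sets under g. *)
Lemma simple_approx_pos (R : realType) : exists a : nat -> R -> R,
  [/\ forall k, exists (N : nat) (c : 'I_N -> R) (B : 'I_N -> set R),
        (forall l, measurable (B l)) /\ (forall t, a k t = \sum_(l < N) c l * \1_(B l) t),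
      forall k t, 0 <= t -> 0 <= a k t <= t
    & forall t, 0 <= t -> a k t @[k --> \oo] --> t].
Proof.
have mid : measurable_fun [set: R] (fun t : R => (Num.max t 0)%:E).
  by apply/measurable_EFinP; apply: measurable_maxr.
pose a k : R -> R := nnsfun_approx measurableT mid k.
have acvg t : 0 <= t -> a k t @[k --> \oo] --> t.
  move=> t0.
  have pos (x : R) : setT x -> (0 <= (Num.max x 0)%:E)%E.
    by move=> _; rewrite lee_fin le_max lexx orbT.
  have := @cvg_nnsfun_approx _ _ _ _ measurableT _ mid pos t I.
  by rewrite max_l// => /fine_cvgP[].
exists a; split=> //.
- move=> k; have mE := fimfunEord (nnsfun_approx measurableT mid k).
  pose r := finmap.enum_fset (fset_set (range (nnsfun_approx measurableT mid k))).
  exists (size r), (fun l => r`_l), (fun l => nnsfun_approx measurableT mid k @^-1` [set r`_l]).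
  by split=> //; exact: mE.
- move=> k t t0; apply/andP; split; first exact: fun_ge0.
  have nd : nondecreasing_seq (fun k => a k t).
    move=> p q pq; have := nd_nnsfun_approx measurableT mid pq.
    by move=> /lefP; exact.
  rewrite -[leRHS](cvg_lim (@Rhausdorff R) (acvg t t0)).
  exact (nondecreasing_cvgn_le nd (cvgP _ (acvg t t0)) k).
Qed.

End simple_approximation.

Section slices.
Context (R : realType) (n : nat) (Omega : set 'rV[R]_n) (M : R).
Hypotheses (oO : open Omega) (OM : Omega `<=` cube M).
Implicit Types (u v w z g phi psi : 'rV[R]_n -> R) (i j : 'I_n).

Local Notation leb := (lebesgue_rV R n).
Local Notation L2 := (L2 Omega).
Local Notation dot := (L2dot Omega).

Let mO : measurable Omega := domain_measurable oO.
Let Ofin : (leb Omega < +oo)%E := domain_fin oO OM.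

Lemma L2_indic (A : set 'rV[R]_n) : measurable A -> L2 (\1_A).
Proof.
move=> mA; apply: (@L2_bounded _ _ _ mO Ofin _ 1); first exact: measurable_indic.
by move=> x _; rewrite indicE; case: (_ \in _); rewrite ?normr1 ?normr0.
Qed.

Lemma dot_indic (A : set 'rV[R]_n) z : measurable A -> L2 z ->
  (dot (\1_A) z)%:E = (\int[leb]_(x in Omega `&` A) (z x)%:E)%E.
Proof.
move=> mA Lz; rewrite /L2dot /Rintegral fineK.
  rewrite integral_mkcondr; apply: eq_integral => x _; rewrite /patch indicE.
  by case: (x \in A); rewrite ?mul1r ?mul0r.
exact: (integrable_fin_num mO (L2_mul mO (L2_indic mA) Lz)).
Qed.

Lemma dot_level_sets_pos g z : L2 g -> L2 z -> measurable_fun setT g -> (forall x, 0 <= g x) ->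
  (forall B : set R, measurable B -> dot (\1_(g @^-1` B)) z = 0) -> dot g z = 0.
Proof.
move=> Lg Lz mg g0 H; have [a [aE ale acvg]] := simple_approx_pos R.
have mB (B : set R) : measurable B -> measurable (g @^-1` B).
  by move=> mB; rewrite -[X in measurable X]setTI; exact: mg.
have aL k : L2 (a k \o g) /\ dot (a k \o g) z = 0.
  have [N [c [B [mBl E]]]] := aE k.
  have -> : a k \o g = (fun x => \sum_(l < N) (c l * \1_(g @^-1` B l) x)).
    by apply/funext => x /=; rewrite E.
  have Ll l : L2 (fun x => c l * \1_(g @^-1` B l) x) by exact: (L2Z mO _ (L2_indic (mB _ (mBl l)))).
  split; first exact: (L2_sum mO Ofin _ Ll).
  rewrite (dot_suml mO Ofin _ Lz Ll) big1// => l _.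
  by rewrite (dotZl mO (c l) Lz (L2_indic (mB _ (mBl l)))) H// mulr0.
suff E0 : (\int[leb]_(x in Omega) (g x * z x)%:E = 0)%E by rewrite /L2dot /Rintegral E0.
apply: (@integral_lim_eq0 _ _ _ leb Omega (fun k x => a k (g x) * z x) (fun x => g x * z x)
  (fun x => `|g x * z x|)) => //.
- by move=> k; apply: measurable_funM; [exact: (aL k).1.1|exact: Lz.1].
- by apply: measurable_funM; [exact: Lg.1|exact: Lz.1].
- by move=> x _; apply: cvgM; [exact: acvg|exact: cvg_cst].
- exact/integrable_norm/(L2_mul mO Lg Lz).
- move=> k x _; have /andP[a0 a1] := ale k _ (g0 x).
  by rewrite !normrM ler_wpM2r// !ger0_norm.
- move=> k; have [Lk] := aL k; rewrite /L2dot/Rintegral => E.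
  by rewrite -(fineK (integrable_fin_num mO (L2_mul mO Lk Lz))) /= [fine _]E.
Qed.

Lemma dot_level_sets g z : L2 g -> L2 z -> measurable_fun setT g ->
  (forall B : set R, measurable B -> dot (\1_(g @^-1` B)) z = 0) -> dot g z = 0.
Proof.
move=> Lg Lz mg H.
pose p (t : R) := Num.max t 0; pose q (t : R) := Num.max (- t) 0.
have mp : measurable_fun setT p by apply: measurable_maxr.
have mq : measurable_fun setT q by apply: measurable_maxr => //; exact: measurable_oppr.
have part (r : R -> R) : measurable_fun setT r -> (forall t, 0 <= r t <= `|t|) ->
    L2 (r \o g) /\ dot (r \o g) z = 0.
  move=> mr r0; have mrg : measurable_fun setT (r \o g) by exact: measurableT_comp.
  have Lr : L2 (r \o g).
    split; first exact: measurable_funTS.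
    apply: (le_integrable mO _ _ Lg.2).
      by apply/measurable_EFinP; apply: measurable_funTS; exact: measurable_funX.
    move=> x _; rewrite /= lee_fin !ger0_norm ?sqr_ge0//.
    have /andP[a0 a1] := r0 (g x).
    by rewrite -(real_normK (num_real (g x))) ler_pXn2r ?nnegrE.
  split=> //; apply: dot_level_sets_pos => //; first by move=> x; have /andP[] := r0 (g x).
  move=> B mB; rewrite comp_preimage; apply: H.
  by rewrite -[X in measurable X]setTI; exact: mr.
have [Lp dp] : L2 (p \o g) /\ dot (p \o g) z = 0.
  by apply: part => // t; rewrite le_max lexx orbT ge_max ler_norm normr_ge0.
have [Lq dq] : L2 (q \o g) /\ dot (q \o g) z = 0.
  by apply: part => // t; rewrite le_max lexx orbT ge_max normr_ge0 -normrN ler_norm.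
have := dotBl mO Lz Lp Lq; rewrite dp dq subrr => <-.
apply: eq_dot => // x _; rewrite /= /p /q.
have [g0|] := boolP (0 <= g x); last rewrite -ltNge => g0.
  by rewrite max_l// max_r ?oppr_le0// subr0.
by rewrite max_r ?(ltW g0)// max_l ?oppr_ge0 ?(ltW g0)// sub0r opprK.
Qed.

(** B is the projection of the level set on the i-th axis. It is Borel because, over each rational
cube inside Omega, it can be read off on the line through the centre of the cube. *)
Lemma cylinder_level_set i g (c : R) : measurable_fun Omega g -> depends_only_on Omega i g ->
  exists2 B : set R, measurable B & Omega `&` [set x | c < g x] = Omega `&` [set x | B (x 0 i)].
Proof.
move=> mg [h gh].
pose line (p : 'rV[rat]_n * nat) (t : R) : 'rV[R]_n :=
  \row_j (if j == i then t else rat_center R p j).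
pose F p := if `[< rat_closed_cube p `<=` Omega >] then
  [set t | `|t - rat_center R p i| < p.2.+1%:R^-1] `&` line p @^-1` (Omega `&` [set x | c < g x])
  else set0.
have mlevel : measurable (Omega `&` [set x | c < g x]).
  have := mg mO `]c, +oo[%classic (measurable_itv _).
  by congr (measurable (_ `&` _)); apply/seteqP; split=> x; rewrite /= in_itv/= andbT.
exists (\bigcup_p F p).
  apply: countable_bigcupT_measurable; first exact: countableP.
  move=> p; rewrite /F; case: ifP => // _; apply: measurableI.
    rewrite (_ : [set t | _] = ball (rat_center R p i) (p.2.+1%:R^-1)).
      exact: measurable_ball.
    by apply/seteqP; split=> t; rewrite /ball/= distrC.
  rewrite -[X in measurable X]setTI; apply: measurable_fun_rVP => // j.
  rewrite (_ : _ \o _ = fun t => if j == i then t else rat_center R p j).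
    by case: (j == i) => //; exact: measurable_id.
  by apply/funext => t; rewrite /= /rV_coord mxE.
apply/seteqP; split=> x [Ox].
  move=> cx; split=> //.
  have [p px pO] := rat_cube_cover oO Ox.
  exists p => //; rewrite /F asboolT//; split; first exact: px.
  have Ol : Omega (line p (x 0 i)).
    apply: pO; apply: rat_cube_subset => j; rewrite mxE.
    by case: eqP => [->|_]; [exact: px|rewrite subrr normr0 invr_gt0].
  by split=> //; rewrite /= (gh _ Ol) mxE eqxx -gh.
move=> [p _]; rewrite /F; case: asboolP => // pO [_ [Ol cl]]; split=> //.
by move: cl; rewrite /= (gh _ Ol) mxE eqxx -gh.
Qed.

(** If z has no flux through almost every hyperplane x_i = t, then it is orthogonal to every
function of x_i. The hypothesis is extended from half-spaces to cylinders over Borel sets, then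
to the sets generated by the level sets of g, which are such cylinders within Omega. *)
Lemma dot_one_variable_eq0 i g z : L2 g -> L2 z -> depends_only_on Omega i g ->
  (forall a : R, dot (\1_[set x | a < x 0 i]) z = 0) -> dot g z = 0.
Proof.
move=> Lg Lz gi H.
have mX : measurable_fun setT (fun x : 'rV[R]_n => x 0 i) := @measurable_rV_coord R n i.
have mXB (B : set R) : measurable B -> measurable [set x : 'rV[R]_n | B (x 0 i)].
  by move=> mB; rewrite -[X in measurable X]setTI; exact: mX.
have iz := L2_integrable mO Ofin Lz.
have intB (B : set R) : measurable B ->
    (\int[leb]_(x in Omega `&` [set x : 'rV[R]_n | B (x 0%R i)]) (z x)%:E = 0)%E.
  pose G := [set A : set 'rV[R]_n | exists a : R, A = [set x | a < x 0 i]].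
  have rayE (a : R) : [set x : 'rV[R]_n | a < x 0 i] =
      [set x : 'rV[R]_n | `]a, +oo[%classic (x 0 i)].
    by apply/seteqP; split=> x; rewrite /= in_itv/= andbT.
  have mray (a : R) : measurable [set x : 'rV[R]_n | a < x 0 i].
    by rewrite rayE; apply: mXB.
  have H' (a : R) : (\int[leb]_(x in Omega `&` [set x : 'rV[R]_n | (a < x 0 i)%R]) (z x)%:E = 0)%E.
    by rewrite -dot_indic// H.
  move=> mB.
  have : <<s G >> [set x | B (x 0 i)].
    have rays (a : R) : <<s G >> ((fun x : 'rV[R]_n => x 0 i) @^-1` `]a, +oo[%classic).
      by apply: sub_sigma_algebra; exists a; exact: (esym (rayE a)).
    exact: (sigma_algebra_preimage_rays (smallest_sigma_algebra setT G) rays mB).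
  apply: integral_pi_system_eq0 => //.
  - move=> _ _ [a ->] [b ->]; exists (Num.max a b).
    by apply/seteqP; split=> x /=; rewrite gt_max; [move=> [-> ->]|move/andP].
  - apply: smallest_sub; first exact: sigma_algebra_measurable.
    by move=> _ [a ->]; exact: mray.
  - have := H' (- M - 1); rewrite (setIidl _)// => x Ox /=.
    by have := OM Ox i; rewrite ler_norml => /andP[+ _]; apply: lt_le_trans; rewrite ltrBlDr ltrDl.
  - by move=> _ [a ->]; exact: H'.
pose g' := g \_ Omega.
have mg' : measurable_fun setT g' by apply/(measurable_restrictT _ mO); exact: Lg.1.
have g'E x : Omega x -> g' x = g x by move=> Ox; rewrite /g' patchE mem_set.
have Lg' : L2 g'.
  split; first exact: measurable_funTS.
  by apply: eq_integrable Lg.2 => // x /set_mem Ox; rewrite g'E.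
rewrite (@eq_dot _ _ _ g z g' z) => [|x Ox|//]; last by rewrite g'E.
apply: dot_level_sets => // B mB.
suff H2 (C : set 'rV[R]_n) : <<s [set A | exists c : R, A = [set x | c < g' x]] >> C ->
    (\int[leb]_(x in Omega `&` C) (z x)%:E = 0)%E.
  have mgB : measurable (g' @^-1` B) by rewrite -[X in measurable X]setTI; exact: mg'.
  suff : (dot (\1_(g' @^-1` B)) z)%:E = 0%E by move=> [].
  rewrite dot_indic//; apply: H2.
  apply: (sigma_algebra_preimage_rays (smallest_sigma_algebra setT _) _ mB) => a.
  apply: sub_sigma_algebra; exists a.
  by apply/seteqP; split=> x; rewrite /= in_itv/= andbT.
have mlev c : measurable [set x | c < g' x].
  have := mg' measurableT `]c, +oo[%classic (measurable_itv _); rewrite setTI.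
  by congr measurable; apply/seteqP; split=> x; rewrite /= in_itv/= andbT.
apply: integral_pi_system_eq0 => //.
- move=> _ _ [a ->] [b ->]; exists (Num.max a b).
  by apply/seteqP; split=> x /=; rewrite gt_max; [move=> [-> ->]|move/andP].
- apply: smallest_sub; first exact: sigma_algebra_measurable.
  by move=> _ [a ->]; exact: mlev.
- by have := intB setT measurableT; rewrite (_ : [set x | _] = setT) ?setIT//; apply/seteqP.
- move=> _ [c ->]; have [A mA E] := cylinder_level_set c Lg.1 gi.
  rewrite -(intB A mA) -E; congr (integral _ _ _).
  by apply/seteqP; split=> x [Ox] /=; rewrite g'E.
Qed.

End slices.

(** * Smooth ramps *)

Section ramp.
Context (R : realType).
Implicit Types (t a : R) (k : nat).

(** A smooth approximation of the positive part of t - a whose derivative is bounded uniformly in k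
and tends to the indicator of t > a. *)
Definition ramp k a t : R := (t - a) * flat_exp 0 (k.+1%:R * (t - a)).

Definition ramp_deriv k a t : R :=
  flat_exp 0 (k.+1%:R * (t - a)) + flat_exp 1 (k.+1%:R * (t - a)).

Lemma mul_flat_exp k t : t * flat_exp k.+1 t = flat_exp k t.
Proof.
rewrite -flat_exp_divt /flat_exp; case: ifPn => [t0|_]; last by rewrite !mulr0.
by rewrite mulVKf// gt_eqF.
Qed.

Lemma ramp_is_derive k a t : is_derive t 1 (ramp k a) (ramp_deriv k a t).
Proof.
have d1 : is_derive t 1 (fun s : R => s - a) 1.
  have := is_deriveD (is_derive_id t 1) (is_derive_cst (- a) t 1).
  by rewrite addr0; apply.
have d2 : is_derive t 1 (fun s : R => k.+1%:R * (s - a)) k.+1%:R.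
  have := is_deriveM (is_derive_cst (k.+1%:R : R) t 1) d1.
  by rewrite scaler0 addr0 [_ *: _]mulr1; apply.
have d3 := @is_derive1_comp _ (flat_exp 0) (fun s : R => k.+1%:R * (s - a)) t _ _
  (flat_exp_is_derive 0 _) d2.
rewrite (_ : ramp k a = (fun s : R => s - a) *
  (flat_exp 0 \o (fun s : R => k.+1%:R * (s - a))))//.
apply: (is_derive_eq (is_deriveM d1 d3)).
rewrite /ramp_deriv /GRing.scale/= mul0r subr0 mulr1 addrC; congr (_ + _).
by rewrite mulrCA mulrA -(mul_flat_exp 1); ring.
Qed.

Lemma ramp_Ck N k a : Ck (fun _ : unit => 1 : R) N (ramp k a).
Proof.
have aff (l b : R) (c : R -> R) : Ck (fun _ : unit => 1 : R) N c ->
    Ck (fun _ : unit => 1 : R) N (fun t => c (l * t + b)).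
  move=> Cc; have cL : continuous (fun t : R => l * t + b).
    by move=> t; exact: (cvgD (cvgM (cvg_cst l) cvg_id) (cvg_cst b)).
  apply: (Ck_affine_comp (a := fun=> l) cL _ Cc) => _ h x.
  by rewrite /GRing.scale/= mulr1; ring.
have := CkM (aff 1 (- a) id (id_Ck R N)) (aff k.+1%:R (- (k.+1%:R * a)) _ (flat_exp_Ck R N 0)).
set f := (X in Ck _ _ X -> _).
suff -> : f = ramp k a by [].
by apply/funext => t; rewrite /f /ramp /= mul1r mulrBr.
Qed.

Lemma flat_exp1_le1 t : flat_exp 1 t <= 1.
Proof.
rewrite /flat_exp; case: ifPn => // t0.
rewrite expr1 expRN ler_pdivrMr ?expR_gt0// mul1r (le_trans _ (expR_ge1Dx _))//.
by rewrite lerDr.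
Qed.

Lemma ramp_deriv_bound k a t : `|ramp_deriv k a t| <= 2.
Proof.
rewrite ger0_norm ?addr_ge0 ?flat_exp_ge0//.
by rewrite [leRHS](_ : _ = 1 + 1)// lerD ?flat_exp0_le1 ?flat_exp1_le1.
Qed.

Lemma ramp_deriv_cvg a t : ramp_deriv k a t @[k --> \oo] --> (\1_[set s | a < s] t : R).
Proof.
have -> : \1_[set s | a < s] t = (0 < t - a)%R%:R + 0 :> R.
  rewrite addr0 indicE subr_gt0; congr (_%:R); case: (boolP (a < t)) => h.
    by rewrite mem_set.
  by rewrite memNset//; exact/negP.
apply: cvgD; first exact: flat_exp0_cvg.
have E : (fun k : nat => flat_exp 1 (k.+1%:R * (t - a))) =
    (fun k => (t - a)^-1 / k.+1%:R * flat_exp 0 (k.+1%:R * (t - a))).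
  by apply/funext => k; rewrite -flat_exp_divt invfM [_ / _]mulrC.
have := cvgM (@cvg_harmonic_scale R (t - a)^-1) (@flat_exp0_cvg R (t - a)).
by rewrite mul0r => H; rewrite E; exact: H.
Qed.

End ramp.

(** * Lower bounds for the Bogovskii constant *)

Section bogovskii_bounds.
Context (R : realType) (n : nat) (Omega : set 'rV[R]_n) (M : R).
Hypotheses (oO : open Omega) (OM : Omega `<=` cube M) (n_gt0 : (0 < n)%N).
Implicit Types (u w z f g phi psi : 'rV[R]_n -> R) (i j : 'I_n).
Implicit Types (v : 'rV[R]_n -> 'rV[R]_n).

Local Notation leb := (lebesgue_rV R n).
Local Notation L2 := (L2 Omega).
Local Notation test := (test_fun Omega).
Local Notation dot := (L2dot Omega).
Local Notation wderiv := (wderiv Omega).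
Local Notation sobolev := (sobolev Omega).
Local Notation sobolev0 := (sobolev0 Omega).
Local Notation ip := (ip Omega).
Local Notation sip := (smooth_ip Omega).

Let mO : measurable Omega := domain_measurable oO.
Let Ofin : (leb Omega < +oo)%E := domain_fin oO OM.

Lemma smooth_coord_comp i (c : R -> R) : (forall N, Ck (fun _ : unit => 1 : R) N c) ->
  smooth (fun x : 'rV[R]_n => c (x 0 i)).
Proof.
move=> Cc; have := smooth_affine_comp i 1 0 Cc.
by rewrite (_ : (fun x : 'rV[R]_n => _) = (fun x : 'rV[R]_n => c (x 0 i)))//;
  apply/funext => x /=; rewrite mul1r addr0.
Qed.

(** The divergence theorem for the field P(x_i) v, which only sees the i-th component of v. *)
Lemma dot_wdiv i (P p : R -> R) m v f :
  (forall N, Ck (fun _ : unit => 1 : R) N P) -> (forall t : R, is_derive t 1 P (p t)) ->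
  vsobolev0 Omega m.+1 v -> L2 f -> ae_eq leb Omega (wdiv Omega v) f ->
  dot (fun x => p (x 0 i)) (vcomp v i) = - dot (fun x => P (x 0 i)) f.
Proof.
move=> CP dP sv Lf vf.
pose G (x : 'rV[R]_n) := P (x 0 i).
have sG : smooth G := smooth_coord_comp i CP.
have LG := L2_smooth oO OM sG.
have Ld j : L2 (wderiv [:: j] (vcomp v j)) by exact: (L2_wderiv oO OM).
have Lw : L2 (wdiv Omega v) := L2_sum mO Ofin _ Ld.
have dG j := pderiv_coord_comp j i dP.
have H j : dot G (wderiv [:: j] (vcomp v j)) =
    - ((j == i)%:R * dot (fun x => p (x 0 i)) (vcomp v j)).
  rewrite (by_parts_sobolev0 oO OM j sG (sv j)) dG.
  have [->|ji] := eqVneq j i.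
    rewrite mul1r; congr (- _); apply: eq_dot => // x _; by rewrite /= mul1r.
  rewrite mul0r -(dot0l mO (vcomp v j)); congr (- _).
  by apply: eq_dot => // x _; rewrite /= mul0r.
have E : dot (fun x => P (x 0 i)) f = - dot (fun x => p (x 0 i)) (vcomp v i).
  rewrite dotC -(L2_ae_eq_dot mO Lw Lf LG vf) dotC.
  refine (etrans (dot_sumr mO Ofin (index_enum _) LG Ld) _).
  refine (etrans (eq_bigr _ (fun j _ => H j)) _).
  rewrite (bigD1 i)// eqxx mul1r big1 => [|j ji]; first exact: addr0.
  by rewrite (negbTE ji) mul0r oppr0.
by rewrite E opprK.
Qed.

Lemma vnorm0_sqr m v : vsobolev0 Omega m v ->
  vnorm0 Omega m v ^+ 2 = \sum_j ip m (vcomp v j) (vcomp v j).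
Proof.
move=> sv; rewrite /vnorm0 sqr_sqrtr// sumr_ge0// => j _.
exact: (ip_ge0 oO OM (sv j).1).
Qed.

Lemma vnorm0_ge m v i : vsobolev0 Omega m v ->
  ip m (vcomp v i) (vcomp v i) <= vnorm0 Omega m v ^+ 2.
Proof.
move=> sv; rewrite vnorm0_sqr// (bigD1 i)//= lerDl sumr_ge0// => j _.
exact: (ip_ge0 oO OM (sv j).1).
Qed.

Lemma le_bogovskii m f (B : R) : Xspace Omega m f -> norm0 Omega m f = 1 ->
  (forall v, vsobolev0 Omega m.+1 v -> ae_eq leb Omega (wdiv Omega v) f ->
    B <= vnorm0 Omega m.+1 v ^+ 2) ->
  (B%:E <= bogovskii Omega m)%E.
Proof.
move=> Xf f1 H; apply: (@le_trans _ _ (ereal_inf [set (vnorm0 Omega m.+1 v ^+ 2)%:E |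
      v in [set v | vsobolev0 Omega m.+1 v /\ ae_eq leb Omega (wdiv Omega v) f]])).
  by apply: le_ereal_inf_tmp => _ [v [sv vf] <-]; rewrite lee_fin; exact: H.
by apply: ereal_sup_ubound; exists f.
Qed.

Lemma mean_wderiv m i u : sobolev0 m.+1 u ->
  \int[leb]_(x in Omega) wderiv [:: i] u x = 0.
Proof.
move=> su; have := by_parts_sobolev0 oO OM i (smooth_cst 1) su.
rewrite pderiv_cst (dot0l mO) oppr0 => <-.
by apply: eq_Rintegral => x _; rewrite /= mul1r.
Qed.

Lemma Xspace_wderiv m i u c : sobolev0 m.+1 u -> Xspace Omega m (fun x => c * wderiv [:: i] u x).
Proof.
move=> su; split.
  exact: (sobolev0Z oO OM c (sobolev0_wderiv1 oO OM i su)).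
rewrite RintegralZl ?(mean_wderiv i su) ?mulr0//.
exact: (L2_integrable mO Ofin (L2_wderiv oO OM [:: i] u)).
Qed.

Lemma norm0_normalize m u : sobolev m u -> 0 < ip m u u ->
  norm0 Omega m (fun x => (Num.sqrt (ip m u u))^-1 * u x) = 1.
Proof.
move=> su u0; rewrite /norm0 (ipZ oO OM _ su) exprVn sqr_sqrtr ?(ltW u0)//.
by rewrite mulVf ?sqrtr1// gt_eqF.
Qed.

(** If d_i u had norm zero, then the Poincare inequality in the direction i would give u = 0. *)
Lemma ip_wderiv1_gt0 m i u : sobolev0 m.+1 u -> 0 < dot u u ->
  0 < ip m (wderiv [:: i] u) (wderiv [:: i] u).
Proof.
move=> su u0; have sdu := sobolev0_wderiv1 oO OM i su.
rewrite lt_neqAle (ip_ge0 oO OM sdu.1) andbT eq_sym; apply/eqP => I0.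
have := poincare_sobolev0 oO OM i sdu; rewrite I0 mulr0 => du0.
have Ldu := L2_wderiv oO OM [:: i] u.
have {}du0 : dot (wderiv [:: i] u) (wderiv [:: i] u) = 0.
  by apply/eqP; rewrite eq_le du0 dot_ge0.
suff : dot u u <= 0 by rewrite leNgt u0.
apply: (@le_of_perturb _ _ _ (8 * M ^+ 2 ) 1) => //.
  by rewrite mulr_ge0 ?sqr_ge0.
move=> d e d0 e0; have [phi tp cl] := sobolev0_close oO OM su e0.
have Lp := L2_test oO OM tp; have Lu := su.1.1.
have Ldp := L2_smooth oO OM (smooth_pderiv i (test_smooth tp)).
have c0 := close_dist2 oO OM Lu tp cl.
have c1 := cl [:: i] isT.
apply: (le_trans (dot_perturb mO Lp Lu d0)); rewrite lerD//.
  rewrite ler_wpM2l ?addr_ge0 ?(ltW d0)// add0r.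
  apply: (le_trans (poincare1 oO OM i tp)).
  have := dot_perturb mO Ldu Ldp (@ltr01 R); rewrite du0 mulr0 add0r invr1 => H.
  apply: (@le_trans _ _ (4 * M ^+ 2 * (2 * e))).
    have K0 : 0 <= 4 * M ^+ 2 by rewrite mulr_ge0// sqr_ge0.
    rewrite ler_wpM2l//; apply: (le_trans H).
    by rewrite ler_wpM2l.
  by rewrite le_eqVlt; apply/orP; left; apply/eqP; ring.
rewrite ler_wpM2l ?addr_ge0 ?invr_ge0 ?(ltW d0)// mul1r.
apply: le_trans c0; rewrite le_eqVlt; apply/orP; left; apply/eqP.
by apply: eq_Rintegral => x _; ring.
Qed.

(** The field w e_i / |d_i w|_m attains this value; the proof shows that no field with the same
divergence does better. *)
Lemma bogovskii_ge_solution m i g w : depends_only_on Omega i g -> L2 g ->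
  polyharmonic_sol Omega m.+1 g w -> 0 < dot w w ->
  ((ip m.+1 w w / ip m (wderiv [:: i] w) (wderiv [:: i] w))%:E <= bogovskii Omega m)%E.
Proof.
move=> gi Lg [sw wE] w0.
set I := ip m.+1 w w; set J := ip m (wderiv _ _) _.
have J0 : 0 < J := ip_wderiv1_gt0 i sw w0.
have sdw := sobolev0_wderiv1 oO OM i sw.
(* Normalization: f = c d_i w has norm one. *)
pose c := (Num.sqrt J)^-1.
have c2 : c ^+ 2 = J^-1 by rewrite /c exprVn sqr_sqrtr// ltW.
apply: (le_bogovskii (Xspace_wderiv i c sw) (norm0_normalize sdw.1 J0)) => v sv vf.
apply: le_trans (vnorm0_ge i sv).
have Lw := sw.1.1; have Lv := (sv i).1.1.
have Lcw := L2Z mO c Lw.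
have Lz := L2B mO Lv Lcw.
have Ldw := L2_wderiv oO OM [:: i] w.
have sr k a : smooth (fun x : 'rV[R]_n => ramp_deriv k a (x 0 i)).
  have := smooth_pderiv i (smooth_coord_comp i (fun N => ramp_Ck N k a)).
  rewrite (pderiv_coord_comp i i (ramp_is_derive k a)) eqxx.
  rewrite (_ : (fun x : 'rV[R]_n => _) = (fun x : 'rV[R]_n => ramp_deriv k a (x 0 i)))//.
  by apply/funext => x; rewrite mul1r.
have ramp0 k a : dot (fun x => ramp_deriv k a (x 0 i)) (fun x => vcomp v i x - c * w x) = 0.
  have Lr := L2_smooth oO OM (sr k a).
  rewrite (dotBr mO Lr Lv Lcw).
  rewrite (dot_wdiv i (fun N => ramp_Ck N k a) (ramp_is_derive k a) sv (L2Z mO c Ldw) vf).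
  have sR := smooth_coord_comp i (fun N => ramp_Ck N k a).
  rewrite (dotZr mO c (L2_smooth oO OM sR) Ldw) (by_parts_sobolev0 oO OM i sR sw).
  rewrite (pderiv_coord_comp i i (ramp_is_derive k a)) eqxx (dotZr mO c Lr Lw).
  rewrite (_ : (fun x : 'rV[R]_n => 1%:R * _) = (fun x : 'rV[R]_n => ramp_deriv k a (x 0 i))).
    by rewrite mulrN opprK subrr.
  by apply/funext => x; rewrite mul1r.
(* The ramps have shown that v_i - c w has no flux; their limits are the half-spaces. *)
have gz : dot g (fun x => vcomp v i x - c * w x) = 0.
  apply: (dot_one_variable_eq0 oO OM Lg Lz gi) => a.
  have mX : measurable_fun setT (fun x : 'rV[R]_n => x 0 i) := @measurable_rV_coord R n i.
  have mr k : measurable_fun setT (fun x : 'rV[R]_n => ramp_deriv k a (x 0 i)).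
    exact: (continuous_rV_measurable (smooth_continuous (sr k a))).
  have mray : measurable [set x : 'rV[R]_n | a < x 0 i].
    rewrite (_ : [set x | _] = (fun x : 'rV[R]_n => x 0 i) @^-1` `]a, +oo[%classic).
      by rewrite -[X in measurable X]setTI; exact: mX.
    by apply/seteqP; split=> x; rewrite /= in_itv/= andbT.
  suff E0 : (\int[leb]_(x in Omega)
      (\1_[set x : 'rV[R]_n | (a < x 0%R i)%R] x * (vcomp v i x - c * w x))%:E = 0)%E.
    by rewrite /L2dot /Rintegral E0.
  apply: (@integral_lim_eq0 _ _ _ leb Omega
    (fun k x => ramp_deriv k a (x 0 i) * (vcomp v i x - c * w x)) _
    (fun x => 2 * `|vcomp v i x - c * w x|)) => //.
  - by move=> k; apply: measurable_funM; [exact: measurable_funTS|exact: Lz.1].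
  - by apply: measurable_funM; [exact: measurable_indic|exact: Lz.1].
  - move=> x _; apply: cvgM; last exact: cvg_cst.
    have := @ramp_deriv_cvg R a (x 0 i); rewrite !indicE.
    by rewrite (_ : (x \in _) = (x 0 i \in [set s | a < s]))//; apply/idP/idP; rewrite !inE.
  - have := integrableZl mO 2 (integrable_norm (L2_integrable mO Ofin Lz)).
    by apply: eq_integrable => // x _; rewrite /= EFinM.
  - by move=> k x _; rewrite normrM ler_wpM2r// ramp_deriv_bound.
  - move=> k; have Lr : L2 (fun x => ramp_deriv k a (x 0 i)).
      apply: (@L2_bounded _ _ _ mO Ofin _ 2) => [|x _]; first exact: measurable_funTS.
      exact: ramp_deriv_bound.
    have := ramp0 k a; rewrite /L2dot/Rintegral => E.
    by rewrite -(fineK (integrable_fin_num mO (L2_mul mO Lr Lz))) /= [fine _]E.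
have gw : dot g w = I by rewrite /I (wE _ sw).
have gv : ip m.+1 w (vcomp v i) = c * I.
  rewrite (wE _ (sv i)) -gw -(dotZr mO c Lg Lw); apply/eqP; rewrite -subr_eq0.
  by rewrite -[X in X - _]/(dot g (vcomp v i)) -(dotBr mO Lg Lv Lcw) gz.
have := ip_CS oO OM sw.1 (sv i).1; rewrite gv exprMn c2 -/I.
have I0 : 0 < I.
  have := poincare_sobolev0 oO OM i sw => H.
  have {H} := lt_le_trans w0 H; rewrite pmulr_rgt0//.
  have K0 : 0 <= 4 * M ^+ 2 by rewrite mulr_ge0// sqr_ge0.
  rewrite lt_neqAle exprn_ge0// andbT.
  apply/eqP => KE; have := lt_le_trans w0 (poincare_sobolev0 oO OM i sw).
  by rewrite -KE mul0r ltxx.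
by rewrite expr2 mulrCA ler_pM2l// mulrC.
Qed.

(** Otherwise the constant function 1 would vanish almost everywhere on Omega. *)
Lemma test_mean_neq0 : Omega !=set0 -> exists2 phi, test phi & dot (cst 1) phi != 0.
Proof.
move=> [x Ox]; apply: contrapT => H.
have L1 := L2_cst mO Ofin (1 : R).
have := dot_test_eq0_ae oO OM L1.
have t0 phi : test phi -> dot (cst 1) phi = 0.
  by move=> tp; apply/eqP; apply: contra_notT H => h; exists phi.
move=> /(_ t0) [A [mA A0 OA]].
have [p px pO] := rat_cube_cover oO Ox.
have sub : rat_open_cube p `<=` A.
  by move=> y yp; apply: OA => /= /(_ (pO _ (rat_cube_subset yp)))/eqP; rewrite oner_eq0.
have : (leb (rat_open_cube p) <= 0)%E.
  by rewrite -A0; apply: le_measure; rewrite ?inE//; exact: measurable_rat_open_cube.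
apply/negP; rewrite -ltNge.
have cE : rat_open_cube p = [set x : 'rV[R]_n | forall j,
    `](rat_center R p j - p.2.+1%:R^-1), (rat_center R p j + p.2.+1%:R^-1)[%classic (x 0 j)].
  by apply/seteqP; split=> y yp j; have := yp j; rewrite /= in_itv/= ltr_distl.
rewrite cE (@lebesgue_rV_box R n (fun j =>
  `](rat_center R p j - p.2.+1%:R^-1), (rat_center R p j + p.2.+1%:R^-1)[%classic))//.
rewrite (eq_bigr (fun=> (2 * p.2.+1%:R^-1)%:E)) => [|j _].
  by rewrite prodEFin lte_fin; apply: prodr_gt0 => j _; rewrite mulr_gt0// invr_gt0.
rewrite lebesgue_measure_itv/= lte_fin ltrBlDr -addrA ltrDl addr_gt0 ?invr_gt0//.
by rewrite -EFinB; congr (_%:E); ring.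
Qed.

(** A test function that is nearly optimal in (int phi)^2 <= l |phi|_(m+1)^2 plays the role of the
solution w for g = 1. *)
Lemma bogovskii_ge_dim m : Omega !=set0 -> (n%:R%:E <= bogovskii Omega m)%E.
Proof.
move=> O0.
pose i0 : 'I_n := Ordinal n_gt0.
have L1 := L2_cst mO Ofin (1 : R).
pose S := [set r : R | exists2 phi, test phi & r = dot (cst 1) phi ^+ 2 / sip m.+1 phi].
pose V := dot (cst 1) (cst 1) * (4 * M ^+ 2) ^+ m.+1.
have V0 : 0 <= V by rewrite mulr_ge0 ?dot_ge0// exprn_ge0// mulr_ge0 ?sqr_ge0.
have bound phi : test phi -> dot (cst 1) phi ^+ 2 <= V * sip m.+1 phi.
  move=> tp; apply: (le_trans (dot_CS mO L1 (L2_test oO OM tp))).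
  by rewrite /V -mulrA ler_wpM2l ?dot_ge0// (poincare oO OM i0).
have ip_pos phi : test phi -> dot (cst 1) phi != 0 -> 0 < sip m.+1 phi.
  move=> tp p0; rewrite lt_neqAle (smooth_ip_ge0 Omega m.+1 phi) andbT eq_sym.
  apply/eqP => I0; have := bound _ tp; rewrite I0 mulr0 leNgt.
  by rewrite lt_neqAle sqr_ge0 andbT eq_sym sqrf_eq0 p0.
have [phi0 tp0 m0] := test_mean_neq0 O0.
have hS : has_sup S.
  split; first by exists (dot (cst 1) phi0 ^+ 2 / sip m.+1 phi0), phi0.
  exists V => _ [phi tp ->].
  have [E|p0] := eqVneq (dot (cst 1) phi) 0; first by rewrite E expr0n mul0r.
  by rewrite ler_pdivrMr ?ip_pos// bound.
pose l := sup S.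
have lS phi : test phi -> dot (cst 1) phi ^+ 2 / sip m.+1 phi <= l.
  by move=> tp; apply: sup_upper_bound => //; exists phi.
have l0 : 0 < l.
  apply: lt_le_trans (lS _ tp0); rewrite divr_gt0 ?ip_pos//.
  by rewrite lt_neqAle sqr_ge0 andbT eq_sym sqrf_eq0.
have lbound phi : test phi -> dot (cst 1) phi ^+ 2 <= l * sip m.+1 phi.
  move=> tp; have [E|p0] := eqVneq (dot (cst 1) phi) 0.
    by rewrite E expr0n mulr_ge0 ?(ltW l0)// smooth_ip_ge0.
  by rewrite -ler_pdivrMr ?ip_pos// lS.
have near_n (d : R) : 0 < d -> d < 1 -> ((n%:R * (1 - d))%:E <= bogovskii Omega m)%E.
  move=> d0 d1.
  have ld : 0 < l * d by rewrite mulr_gt0.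
  have [_ [phi tp ->]] := sup_adherent ld hS; rewrite -/l => near_sup.
  have lt0 : 0 < l - l * d by rewrite subr_gt0 gtr_pMr.
  have p0 : dot (cst 1) phi != 0.
    apply/eqP => E; have := lt_trans lt0 near_sup.
    by rewrite E expr0n mul0r ltxx.
  have I0 := ip_pos _ tp p0.
  set I := sip m.+1 phi in I0 near_sup *.
  (* The n numbers |d_i phi|_m^2 add up to I. *)
  have [i Hi] : exists i, sip m (pderiv i phi) <= I / n%:R.
    apply: contrapT => H.
    have : \sum_(i < n) I / n%:R < \sum_i sip m (pderiv i phi).
      apply: ltr_sum; first by apply/hasP; exists i0 => //; exact: mem_index_enum.
      by move=> i _; rewrite ltNge; apply/negP => h; apply: H; exists i.
    rewrite (smooth_ip_gradient oO OM m tp) sumr_const card_ord -[_ *+ n]mulr_natr divfK ?ltxx//.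
    by rewrite pnatr_eq0 -lt0n.
  have Lp := L2_test oO OM tp.
  have tdp := test_pderiv i tp; have Ldp := L2_test oO OM tdp.
  set J := sip m (pderiv i phi) in Hi.
  have J0 : 0 < J.
    rewrite lt_neqAle (smooth_ip_ge0 Omega m _) andbT eq_sym; apply/eqP => JE.
    have := poincare1 oO OM i tp; have := poincare oO OM i m tdp.
    rewrite -/J JE mulr0 => dp0 pp.
    have {}pp : dot phi phi <= 0.
      by apply: (le_trans pp); rewrite mulr_ge0_le0// mulr_ge0// sqr_ge0.
    have := dot_CS mO L1 Lp; rewrite leNgt => /negP; apply.
    apply: (@le_lt_trans _ _ 0); first by rewrite mulr_ge0_le0// dot_ge0.
    by rewrite lt_neqAle sqr_ge0 andbT eq_sym sqrf_eq0.
  have sdp := sobolev0_test oO OM m tdp.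
  have JE : ip m (pderiv i phi) (pderiv i phi) = J := smooth_ipE oO OM m (test_smooth tdp).
  pose c := (Num.sqrt J)^-1.
  have c2 : c ^+ 2 = J^-1 by rewrite /c exprVn sqr_sqrtr// ltW.
  have Xf : Xspace Omega m (fun x => c * pderiv i phi x).
    split; first exact: (sobolev0Z oO OM c sdp).
    rewrite (RintegralZl c mO (L2_integrable mO Ofin Ldp)).
    by rewrite (integral_test_pderiv i tp) mulr0.
  have f1 : norm0 Omega m (fun x => c * pderiv i phi x) = 1.
    by rewrite /c -JE; apply: (norm0_normalize sdp.1); rewrite JE.
  apply: (le_bogovskii Xf f1) => v sv vf.
  apply: le_trans (vnorm0_ge i sv).
  have mv : dot (cst 1) (vcomp v i) = c * dot (cst 1) phi.
    rewrite (dot_wdiv i (id_Ck R) (fun t : R => is_derive_id t 1) sv (L2Z mO c Ldp) vf).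
    rewrite (dotZr mO c (L2_smooth oO OM (smooth_coord R i)) Ldp).
    rewrite (by_parts oO OM i (smooth_coord R i) tp).
    by rewrite pderiv_coord eqxx mulrN opprK.
  have := sqr_mean_sobolev0_le oO OM n_gt0 (ltW l0) lbound (sv i).
  rewrite mv exprMn c2 => H.
  have {}near_sup : (l - l * d) * I < dot (cst 1) phi ^+ 2 by rewrite -ltr_pdivlMr.
  have nJ : n%:R <= J^-1 * I.
    rewrite mulrC ler_pdivlMr// mulrC -ler_pdivlMr// ltr0n.
    exact: n_gt0.
  rewrite -(ler_pM2l l0); apply: le_trans H.
  apply: (@le_trans _ _ (J^-1 * ((l - l * d) * I))); last first.
    by rewrite ler_wpM2l ?invr_ge0 ?(ltW J0)// ltW.
  rewrite (_ : J^-1 * _ = l * (J^-1 * I * (1 - d))); last by ring.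
  by rewrite ler_wpM2l ?(ltW l0)// ler_wpM2r// subr_ge0 ltW.
apply/lee_addgt0Pr => e e0.
have n0 : 0 < n%:R :> R by rewrite ltr0n.
pose d := Num.min (e / n%:R) 2^-1.
have d0 : 0 < d by rewrite lt_min (divr_gt0 e0 n0) invr_gt0 ltr0n.
have d1 : d < 1 by rewrite gt_min invf_lt1// ltr1n orbT.
rewrite -leeBlDr//; apply: le_trans (near_n d d0 d1).
rewrite -EFinB lee_fin mulrBr mulr1 lerD2l lerN2.
by rewrite mulrC -ler_pdivlMr// ge_min lexx.
Qed.

End bogovskii_bounds.

Lemma bounded_set_cube (R : realType) n (A : set 'rV[R]_n) : bounded_set A ->
  exists M : R, A `<=` cube M.
Proof.
move=> [K [_ HK]]; exists (K + 1) => x Ax j.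
have K1 : K < K + 1 by rewrite ltrDl.
have := HK (K + 1) K1 x Ax.
by apply: le_trans; exact: coord_le_norm.
Qed.

Unset Implicit Arguments.

Theorem theorem4p3 (R : realType) (n : nat) (Omega : set 'rV[R]_n) (m : nat) :
  (2 <= n)%N -> bounded_lipschitz_domain Omega ->
  (n%:R%:E <= bogovskii Omega m)%E /\
  ((exists (i : 'I_n) (g w : 'rV[R]_n -> R),
      [/\ depends_only_on Omega i g, L2 Omega g, polyharmonic_sol Omega m.+1 g w &
          norm0 Omega m (wderiv Omega [:: i] w) ^+ 2 < n%:R^-1 * norm0 Omega m.+1 w ^+ 2]) ->
   (n%:R%:E < bogovskii Omega m)%E).
Proof.
move=> n2; case=> O0 oO _ /bounded_set_cube[M OM] _.
have n0 : (0 < n)%N by exact: ltnW.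
split; first exact: (bogovskii_ge_dim oO OM n0 m O0).
move=> [i [g [w [gi Lg sol]]]].
have [sw wE] := sol.
have sdw := sobolev0_wderiv1 oO OM i sw.
rewrite (norm0_sqr oO OM sw.1) (norm0_sqr oO OM sdw.1) => IJ.
have mO := domain_measurable oO; have Ofin := domain_fin oO OM.
have w0 : 0 < L2dot Omega w w.
  rewrite lt_neqAle dot_ge0 andbT eq_sym; apply/eqP => ww0.
  have wae := dot_eq0_ae mO sw.1.1 ww0.
  have gw0 : L2dot Omega g w = 0.
    rewrite dotC (L2_ae_eq_dot mO sw.1.1 (L2_cst mO Ofin 0) Lg wae).
    exact: (dot0l mO).
  have I0 : ip Omega m.+1 w w = 0 by rewrite (wE _ sw); exact: gw0.
  by move: IJ; rewrite I0 mulr0 ltNge (ip_ge0 oO OM sdw.1).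
have J0 := ip_wderiv1_gt0 oO OM i sw w0.
apply: lt_le_trans (bogovskii_ge_solution oO OM gi Lg sol w0).
by rewrite lte_fin ltr_pdivlMr// -ltr_pdivlMl// ltr0n.
Qed.
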